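(* Let $W$ be an arbitrary irreducible (classical or exceptional) finite Weyl group and $V$ its irreducible reflection representation over $\mathbb{C}$. Let $\mathbb{C}W^-$ be the spin Weyl group superalgebra, $\mathfrak{H}^{\mathfrak c}_W=\mathcal{C}l_V\rtimes W$ the Hecke-Clifford superalgebra, $\mathcal{B}_W$ the basic spin $\mathbb{C}W^-$-module, and $\mathfrak{G}=\mathrm{Hom}_{\mathcal{C}l_V}(U,-)$ the functor from $\mathfrak{H}^{\mathfrak c}_W$-modules to $\mathbb{C}W^-$-modules. Then: (1) The $\mathbb{C}W^-$-module $\mathcal{B}_W$ is simple, of type $\mathtt{M}$ if $\dim V$ is even and of type $\mathtt{Q}$ if $\dim V$ is odd. (2) $\mathfrak{G}(\mathcal{C}l_V)\cong\mathcal{B}_W$ as $\mathbb{C}W^-$-modules. (3) $\mathcal{C}l_V$ is a simple $\mathfrak{H}^{\mathfrak c}_W$-module, always of type $\mathtt{M}$.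
   Context: All algebras and modules are finite-dimensional over $\mathbb{C}$. Modules over a superalgebra $A$ are $\mathbb{Z}_2$-graded, simple means no proper nonzero graded submodule, $\mathrm{Hom}_A(M,N)$ is spanned by all homogeneous (even and odd) linear maps $f$ with $f(am)=(-1)^{|f||a|}af(m)$, and isomorphisms may be even or odd. A simple $M$ is of type $\mathtt{M}$ if $\dim\mathrm{Hom}_A(M,M)=1$ and of type $\mathtt{Q}$ if this dimension is $2$. Tensor products of superalgebras have $(a\otimes b)(a'\otimes b')=(-1)^{|b||a'|}aa'\otimes bb'$. Let $W=\langle s_1,\dots,s_n\mid(s_is_j)^{m_{ij}}=1\rangle$ be the Coxeter presentation ($m_{ii}=1$), $n=\dim V$. $\mathbb{C}W^-$ is the algebra generated by $t_1,\dots,t_n$ with relations $(t_it_j)^{m_{ij}}=(-1)^{m_{ij}+1}$, a superalgebra with each $t_i$ odd. $V$ carries the $W$-invariant nondegenerate symmetric bilinear form $(\cdot,\cdot)$ (positive definite on the real form), and $\mathcal{C}l_V$ is the Clifford superalgebra generated by odd elements $v\in V$ with $vw+wv=2(v,w)$. Let $\beta_i\in\mathcal{C}l_V$ correspond to the simple root $\alpha_i$ normalized so that $\beta_i^2=1$. $W$ acts on $\mathcal{C}l_V$ by automorphisms, $\mathfrak{H}^{\mathfrak c}_W=\mathcal{C}l_V\rtimes W$ has elements of $W$ even, and $\mathcal{C}l_V$ is an $\mathfrak{H}^{\mathfrak c}_W$-module with $\mathcal{C}l_V$ acting by left multiplication and $W$ by automorphisms. $\mathcal{C}l_V$ is a simple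 superalgebra with a unique (up to isomorphism) simple module $U$. There is a superalgebra homomorphism $\Omega:\mathbb{C}W^-\to\mathcal{C}l_V$, $t_i\mapsto\beta_i$; $\mathcal{B}_W$ is the pullback of $U$ via $\Omega$. There is a superalgebra isomorphism $\Phi:\mathfrak{H}^{\mathfrak c}_W\to\mathcal{C}l_V\otimes\mathbb{C}W^-$, identity on $\mathcal{C}l_V$, $s_i\mapsto-\sqrt{-1}\,\beta_it_i$, with inverse sending $t_i\mapsto\sqrt{-1}\,\beta_is_i$. For an $\mathfrak{H}^{\mathfrak c}_W$-module $N$, $\mathfrak{G}(N)=\mathrm{Hom}_{\mathcal{C}l_V}(U,N)$ is a $\mathbb{C}W^-$-module via $(t_if)(u)=\sqrt{-1}\,\beta_is_i\cdot f(u)$. *)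

(* Defs.v *)
From HB Require Import structures.
From mathcomp Require Import all_boot all_order all_algebra all_fingroup.
From mathcomp Require Import cyclic mxrepresentation generic_quotient.
From mathcomp Require Import mathcomp_extra boolp functions reals.
From mathcomp Require Import complex ring.

Set Implicit Arguments.
Unset Strict Implicit.
Unset Printing Implicit Defensive.

Import Order.TTheory GRing.Theory Num.Theory.
Local Open Scope ring_scope.

(******************************************************************************)
(* Unital associative algebras given by generators and relations: formal      *)
(* expressions modulo the least congruence containing the algebra axioms and  *)
(* the relations.                                                             *)
(******************************************************************************)

Section Terms.
Variable F : fieldType.

Inductive term (X : Type) : Type :=
| TVar of X
| TConst of F
| TAdd of term X & term X
| TMul of term X & term X.

Fixpoint TExp X (t : term X) (k : nat) : term X :=
  if k is k'.+1 then TMul t (TExp t k') else TConst X 1.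

Inductive cong X (rel : term X -> term X -> Prop) : term X -> term X -> Prop :=
| cong_rel s t : rel s t -> cong rel s t
| cong_refl t : cong rel t t
| cong_sym s t : cong rel s t -> cong rel t s
| cong_trans s t u : cong rel s t -> cong rel t u -> cong rel s u
| cong_add s s' t t' :
    cong rel s s' -> cong rel t t' -> cong rel (TAdd s t) (TAdd s' t')
| cong_mul s s' t t' :
    cong rel s s' -> cong rel t t' -> cong rel (TMul s t) (TMul s' t')
| cong_addA s t u : cong rel (TAdd s (TAdd t u)) (TAdd (TAdd s t) u)
| cong_addC s t : cong rel (TAdd s t) (TAdd t s)
| cong_add0 t : cong rel (TAdd (TConst X 0) t) t
| cong_addN t : cong rel (TAdd (TMul (TConst X (-1)) t) t) (TConst X 0)
| cong_mulA s t u : cong rel (TMul s (TMul t u)) (TMul (TMul s t) u)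
| cong_mul1l t : cong rel (TMul (TConst X 1) t) t
| cong_mul1r t : cong rel (TMul t (TConst X 1)) t
| cong_mulDl s t u : cong rel (TMul (TAdd s t) u) (TAdd (TMul s u) (TMul t u))
| cong_mulDr s t u : cong rel (TMul u (TAdd s t)) (TAdd (TMul u s) (TMul u t))
| cong_constD a b : cong rel (TConst X (a + b)) (TAdd (TConst X a) (TConst X b))
| cong_constM a b : cong rel (TConst X (a * b)) (TMul (TConst X a) (TConst X b))
| cong_constC a t : cong rel (TMul (TConst X a) t) (TMul t (TConst X a)).

Fixpoint tneg X (t : term X) : term X :=
  match t with
  | TVar x => TMul (TConst X (-1)) (TVar x)
  | TConst c => TConst X c
  | TAdd s t => TAdd (tneg s) (tneg t)
  | TMul s t => TMul (tneg s) (tneg t)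
  end.

(* Homogeneous expressions, every generator being odd. *)
Inductive thomog X : bool -> term X -> Prop :=
| thomog_var x : thomog true (TVar x)
| thomog_const c : thomog false (TConst X c)
| thomog_zero : thomog true (TConst X 0)
| thomog_add b s t : thomog b s -> thomog b t -> thomog b (TAdd s t)
| thomog_mul b c s t :
    thomog b s -> thomog c t -> thomog (b (+) c) (TMul s t).

Record presentation := Presentation {
  gens : Type;
  rels : term gens -> term gens -> Prop;
  nontrivial : ~ cong rels (TConst gens 1) (TConst gens 0) }.

Lemma cong_zero X (rel : term X -> term X -> Prop) t :
  cong rel (TMul (TConst X 0) t) (TConst X 0).
Proof.
apply: cong_trans (cong_addN rel t).
have h : cong rel (TConst X 0) (TAdd (TConst X (-1)) (TConst X 1)).
  by apply: cong_trans (cong_constD _ _ _); rewrite addNr; apply: cong_refl.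
apply: cong_trans (cong_mul h (cong_refl _ _)) _.
apply: cong_trans (cong_mulDl _ _ _ _) _.
by apply: cong_add; [apply: cong_refl | apply: cong_mul1l].
Qed.

Section Action.
Variables (X : Type) (M : lmodType F) (g : X -> M -> M).

Fixpoint tact (t : term X) : M -> M :=
  match t with
  | TVar x => g x
  | TConst c => fun m => c *: m
  | TAdd s t => fun m => tact s m + tact t m
  | TMul s t => fun m => tact s (tact t m)
  end.

Hypothesis gL : forall x, linear (g x).

Lemma tact_linear t : linear (tact t).
Proof.
elim: t => [x|c|s hs t ht|s hs t ht] //= a u v.
- by rewrite scalerDr !scalerA mulrC.
- by rewrite hs ht scalerDr addrACA.
- by rewrite ht hs.
Qed.

Lemma tactD t u v : tact t (u + v) = tact t u + tact t v.
Proof. by have := tact_linear t 1 u v; rewrite !scale1r. Qed.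

Lemma tactZ t a u : tact t (a *: u) = a *: tact t u.
Proof.
have t0 : tact t 0 = 0.
  by have := tact_linear t (-1) 0 0; rewrite scaler0 addr0 scaleN1r addNr.
by have := tact_linear t a u 0; rewrite !addr0 t0 addr0.
Qed.

Lemma tact_cong (rel : term X -> term X -> Prop) :
  (forall s t, rel s t -> tact s =1 tact t) ->
  forall s t, cong rel s t -> tact s =1 tact t.
Proof.
move=> hrel s t; elim=> {s t} /=.
- exact: hrel.
- by [].
- by move=> s t _ h m; rewrite h.
- by move=> s t u _ h1 _ h2 m; rewrite h1 h2.
- by move=> s s' t t' _ h1 _ h2 m; rewrite h1 h2.
- by move=> s s' t t' _ h1 _ h2 m; rewrite h2 h1.
- by move=> s t u m; rewrite addrA.
- by move=> s t m; rewrite addrC.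
- by move=> t m; rewrite scale0r add0r.
- by move=> t m; rewrite scaleN1r addNr scale0r.
- by [].
- by move=> t m; rewrite scale1r.
- by move=> t m; rewrite scale1r.
- by [].
- by move=> s t u m; rewrite tactD.
- by move=> a b m; rewrite scalerDl.
- by move=> a b m; rewrite scalerA.
- by move=> a t m; rewrite tactZ.
Qed.

End Action.

End Terms.

Arguments TConst {F X}.
Arguments TVar {F X}.

Section PresentedAlgebra.
Variables (F : fieldType) (P : presentation F).

Definition pterm : choiceType := {classic term F (gens P)}.
Definition pequiv : rel pterm := fun s t => `[< cong (@rels F P) s t >].

Lemma pequiv_equiv : equiv_class_of pequiv.
Proof.
split.
- by move=> t; apply/asboolP; apply: cong_refl.
- move=> s t; apply/asboolP/asboolP; exact: cong_sym.
- by move=> t s u /asboolP h1 /asboolP h2; apply/asboolP; apply: cong_trans h1 h2.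
Qed.

Canonical pequiv_rel := EquivRelPack pequiv_equiv.

Definition palg : Type := {eq_quot pequiv_rel}%qT.
HB.instance Definition _ := Choice.on palg.

Definition pcls (t : term F (gens P)) : palg :=
  (\pi_({eq_quot pequiv_rel})%qT (t : pterm)).
Definition prepr (x : palg) : term F (gens P) := repr (x : {eq_quot pequiv_rel}%qT).

Lemma preprK x : pcls (prepr x) = x.
Proof. exact: reprK. Qed.

Lemma pclsP s t : pcls s = pcls t <-> cong (@rels F P) s t.
Proof.
split=> [/eqmodP /asboolP //|h]; apply/eqmodP/asboolP/h.
Qed.

Lemma prepr_cong t : cong (@rels F P) (prepr (pcls t)) t.
Proof. by apply/pclsP; rewrite preprK. Qed.

Definition padd x y := pcls (TAdd (prepr x) (prepr y)).
Definition pmul x y := pcls (TMul (prepr x) (prepr y)).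
Definition popp x := pcls (TMul (TConst (-1)) (prepr x)).
Definition pscale (a : F) x := pcls (TMul (TConst a) (prepr x)).

Lemma paddE s t : padd (pcls s) (pcls t) = pcls (TAdd s t).
Proof. by apply/pclsP; apply: cong_add; apply: prepr_cong. Qed.
Lemma pmulE s t : pmul (pcls s) (pcls t) = pcls (TMul s t).
Proof. by apply/pclsP; apply: cong_mul; apply: prepr_cong. Qed.
Lemma poppE t : popp (pcls t) = pcls (TMul (TConst (-1)) t).
Proof. by apply/pclsP; apply: cong_mul (prepr_cong _); apply: cong_refl. Qed.
Lemma pscaleE a t : pscale a (pcls t) = pcls (TMul (TConst a) t).
Proof. by apply/pclsP; apply: cong_mul (prepr_cong _); apply: cong_refl. Qed.

Definition pE := (paddE, pmulE, poppE, pscaleE).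

Lemma palg_ind (Q : palg -> Prop) : (forall t, Q (pcls t)) -> forall x, Q x.
Proof. by move=> h x; rewrite -(preprK x). Qed.

Fact paddA : associative padd.
Proof.
elim/palg_ind=> s; elim/palg_ind=> t; elim/palg_ind=> u; rewrite !pE.
by apply/pclsP; apply: cong_addA.
Qed.
Fact paddC : commutative padd.
Proof.
elim/palg_ind=> s; elim/palg_ind=> t; rewrite !pE.
by apply/pclsP; apply: cong_addC.
Qed.
Fact padd0 : left_id (pcls (TConst 0)) padd.
Proof. by elim/palg_ind=> s; rewrite !pE; apply/pclsP; apply: cong_add0. Qed.
Fact paddN : left_inverse (pcls (TConst 0)) popp padd.
Proof. by elim/palg_ind=> s; rewrite !pE; apply/pclsP; apply: cong_addN. Qed.

HB.instance Definition _ := GRing.isZmodule.Build palg paddA paddC padd0 paddN.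

Fact pmulA : associative pmul.
Proof.
elim/palg_ind=> s; elim/palg_ind=> t; elim/palg_ind=> u; rewrite !pE.
by apply/pclsP; apply: cong_mulA.
Qed.
Fact pmul1 : left_id (pcls (TConst 1)) pmul.
Proof. by elim/palg_ind=> s; rewrite !pE; apply/pclsP; apply: cong_mul1l. Qed.
Fact pmulr1 : right_id (pcls (TConst 1)) pmul.
Proof. by elim/palg_ind=> s; rewrite !pE; apply/pclsP; apply: cong_mul1r. Qed.
Fact pmulDl : left_distributive pmul +%R.
Proof.
elim/palg_ind=> s; elim/palg_ind=> t; elim/palg_ind=> u.
by rewrite /+%R /= !pE; apply/pclsP; apply: cong_mulDl.
Qed.
Fact pmulDr : right_distributive pmul +%R.
Proof.
elim/palg_ind=> s; elim/palg_ind=> t; elim/palg_ind=> u.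
by rewrite /+%R /= !pE; apply/pclsP; apply: cong_mulDr.
Qed.
Fact pone_neq0 : pcls (TConst 1) != 0 :> palg.
Proof. by apply/eqP=> /pclsP; apply: nontrivial. Qed.

HB.instance Definition _ := GRing.Zmodule_isNzRing.Build palg
  pmulA pmul1 pmulr1 pmulDl pmulDr pone_neq0.

Fact pscaleA a b x : pscale a (pscale b x) = pscale (a * b) x.
Proof.
elim/palg_ind: x => t; rewrite !pE; apply/pclsP.
apply: cong_trans (cong_mulA _ _ _ _) _.
by apply: cong_mul (cong_refl _ _); apply/cong_sym/cong_constM.
Qed.
Fact pscale1 : left_id 1 pscale.
Proof. by elim/palg_ind=> t; rewrite !pE; apply/pclsP; apply: cong_mul1l. Qed.
Fact pscaleDr : right_distributive pscale +%R.
Proof.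
move=> a; elim/palg_ind=> t; elim/palg_ind=> u.
by rewrite /+%R /= !pE; apply/pclsP; apply: cong_mulDr.
Qed.
Fact pscaleDl x : {morph pscale^~ x : a b / a + b}.
Proof.
move=> a b; elim/palg_ind: x => t.
rewrite [in RHS]/+%R /= !pE; apply/pclsP.
by apply: cong_trans (cong_mulDl _ _ _ _); apply: cong_mul (cong_refl _ _); apply: cong_constD.
Qed.

HB.instance Definition _ := GRing.Zmodule_isLmodule.Build F palg
  pscaleA pscale1 pscaleDr pscaleDl.

Fact pscaleAl (a : F) (x y : palg) : a *: (x * y) = (a *: x) * y.
Proof.
elim/palg_ind: x => t; elim/palg_ind: y => u.
by rewrite /*:%R /*%R /= !pE; apply/pclsP; apply: cong_mulA.
Qed.
HB.instance Definition _ := GRing.Lmodule_isLalgebra.Build F palg pscaleAl.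

Fact pscaleAr (a : F) (x y : palg) : a *: (x * y) = x * (a *: y).
Proof.
elim/palg_ind: x => t; elim/palg_ind: y => u.
rewrite /*:%R /*%R /= !pE; apply/pclsP.
apply: cong_trans (cong_mulA _ _ _ _) _.
apply: cong_trans (cong_mul (cong_constC _ _ _) (cong_refl _ _)) _.
exact/cong_sym/cong_mulA.
Qed.
HB.instance Definition _ := GRing.Lalgebra_isAlgebra.Build F palg pscaleAr.

Definition pgen (x : gens P) : palg := pcls (TVar x).

Lemma pclsD s t : pcls (TAdd s t) = pcls s + pcls t.
Proof. by rewrite -paddE. Qed.
Lemma pclsM s t : pcls (TMul s t) = pcls s * pcls t.
Proof. by rewrite -pmulE. Qed.
Lemma pclsC c : pcls (TConst c) = c%:A.
Proof.
rewrite /GRing.scale /= [1]/(pcls (TConst 1)) pscaleE; apply/pclsP.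
exact/cong_sym/cong_mul1r.
Qed.
Lemma pclsX t k : pcls (TExp t k) = pcls t ^+ k.
Proof. by elim: k => [|k IH] //=; rewrite pclsM IH exprS. Qed.

End PresentedAlgebra.

Arguments pgen {F} P x.

(* The algebra morphism out of a presented algebra sending the generator x to *)
(* g x, provided g respects the relations.                                    *)
Section Lift.
Variables (F : fieldType) (P : presentation F) (B : algType F).
Variable (g : gens P -> B).

Fixpoint teval (t : term F (gens P)) : B :=
  match t with
  | TVar x => g x
  | TConst c => c%:A
  | TAdd s t => teval s + teval t
  | TMul s t => teval s * teval t
  end.

Lemma tevalX t k : teval (TExp t k) = teval t ^+ k.
Proof. by elim: k => [|k IH] /=; rewrite ?scale1r // IH exprS. Qed.

Definition respects := forall s t, rels s t -> teval s = teval t.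

Definition plift (x : palg P) : B := teval (prepr x).

Hypothesis gP : respects.

Lemma teval_cong s t : cong (@rels F P) s t -> teval s = teval t.
Proof.
elim=> {s t} //=.
- by move=> s t u _ -> _ ->.
- by move=> s s' t t' _ -> _ ->.
- by move=> s s' t t' _ -> _ ->.
- by move=> s t u; rewrite addrA.
- by move=> s t; rewrite addrC.
- by move=> t; rewrite scale0r add0r.
- by move=> t; rewrite scaleN1r mulN1r addNr scale0r.
- by move=> s t u; rewrite mulrA.
- by move=> t; rewrite scale1r mul1r.
- by move=> t; rewrite scale1r mulr1.
- by move=> s t u; rewrite mulrDl.
- by move=> s t u; rewrite mulrDr.
- by move=> a b; rewrite scalerDl.
- by move=> a b; rewrite -scalerAl mul1r scalerA.
- by move=> a t; rewrite -scalerAl -scalerAr mul1r mulr1.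
Qed.

Lemma plift_cls t : plift (pcls t) = teval t.
Proof. by apply: teval_cong; apply: prepr_cong. Qed.

Lemma plift_gen x : plift (pgen P x) = g x.
Proof. by rewrite plift_cls. Qed.

Lemma plift_linear : linear plift.
Proof.
move=> a; elim/palg_ind=> s; elim/palg_ind=> t.
by rewrite -mulr_algl -pclsC -pclsM -pclsD !plift_cls /= mulr_algl.
Qed.

Lemma plift_monoid : monoid_morphism plift.
Proof.
split; first by rewrite -[1]/(pcls (TConst 1)) plift_cls /= scale1r.
by elim/palg_ind=> s; elim/palg_ind=> t; rewrite -pclsM !plift_cls.
Qed.

End Lift.

(******************************************************************************)
(* In superalgebras and supermodules the boolean index is the parity.         *)
(******************************************************************************)

Section Super.
Variable F : fieldType.

Definition subspace (V : lmodType F) (p : V -> Prop) :=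
  p 0 /\ forall a u v, p u -> p v -> p (a *: u + v).

(* V is the direct sum of p false and p true. *)
Record graded (V : lmodType F) (p : bool -> V -> Prop) : Prop := Graded {
  graded_sub : forall b, subspace (p b);
  graded_sum : forall v, exists v0 v1, [/\ p false v0, p true v1 & v = v0 + v1];
  graded_cap : forall v, p false v -> p true v -> v = 0 }.

Record superalg := SuperAlg {
  sa_alg :> algType F;
  sa_part : bool -> sa_alg -> Prop;
  sa_graded : graded sa_part;
  sa_part1 : sa_part false 1;
  sa_partM : forall b c x y,
    sa_part b x -> sa_part c y -> sa_part (b (+) c) (x * y) }.

Record superhom (A B : superalg) := SuperHom {
  sh_fun :> A -> B;
  sh_linear : linear sh_fun;
  sh_monoid : monoid_morphism sh_fun;
  sh_part : forall b x, sa_part b x -> sa_part b (sh_fun x) }.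

Definition sh_id (A : superalg) : superhom A A :=
  @SuperHom A A id (fun a u v => erefl) (conj erefl (fun x y => erefl))
    (fun b x hx => hx).

Fact sh_comp_linear (A B D : superalg) (f : superhom B D) (h : superhom A B) :
  linear (f \o h).
Proof. by move=> a u v /=; rewrite !sh_linear. Qed.
Fact sh_comp_monoid (A B D : superalg) (f : superhom B D) (h : superhom A B) :
  monoid_morphism (f \o h).
Proof.
split=> [|x y] /=; first by rewrite !(sh_monoid _).1.
by rewrite !(sh_monoid _).2.
Qed.

Definition sh_comp (A B D : superalg) (f : superhom B D) (h : superhom A B) :
    superhom A D :=
  @SuperHom A D (f \o h) (sh_comp_linear f h) (sh_comp_monoid f h)
    (fun b x hx => sh_part f (sh_part h hx)).

Record smodule (A : superalg) := SModule {
  sm_mod :> lmodType F;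
  sm_part : bool -> sm_mod -> Prop;
  sm_act : A -> sm_mod -> sm_mod;
  sm_graded : graded sm_part;
  sm_actl : forall m, linear (sm_act^~ m);
  sm_actr : forall a, linear (sm_act a);
  sm_act1 : forall m, sm_act 1 m = m;
  sm_actM : forall a b m, sm_act (a * b) m = sm_act a (sm_act b m);
  sm_act_part : forall b c a m,
    sa_part b a -> sm_part c m -> sm_part (b (+) c) (sm_act a m) }.

Definition has_dim (V : lmodType F) (k : nat) :=
  exists f : V -> 'rV[F]_k, linear f /\ bijective f.

Definition fin_dim (V : lmodType F) := exists k, has_dim V k.

Lemma sub0 (V : lmodType F) (p : V -> Prop) : subspace p -> p 0.
Proof. by case. Qed.

Lemma subD (V : lmodType F) (p : V -> Prop) u v :
  subspace p -> p u -> p v -> p (u + v).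
Proof. by move=> [_ h] hu hv; rewrite -[u]scale1r; apply: h. Qed.

Lemma subZ (V : lmodType F) (p : V -> Prop) a u :
  subspace p -> p u -> p (a *: u).
Proof. by move=> [h0 h] hu; rewrite -[_ *: _]addr0; apply: h. Qed.

Lemma subN (V : lmodType F) (p : V -> Prop) u : subspace p -> p u -> p (- u).
Proof. by move=> hp hu; rewrite -scaleN1r; apply: subZ. Qed.

Lemma linZ (V W : lmodType F) (f : V -> W) a u : linear f -> f (a *: u) = a *: f u.
Proof.
move=> hf; have f0 : f 0 = 0.
  by have := hf (-1) 0 0; rewrite scaler0 addr0 scaleN1r addNr.
by have := hf a u 0; rewrite !addr0 f0 addr0.
Qed.
Lemma linD (V W : lmodType F) (f : V -> W) u v : linear f -> f (u + v) = f u + f v.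
Proof. by move=> hf; have := hf 1 u v; rewrite !scale1r. Qed.
Lemma lin0 (V W : lmodType F) (f : V -> W) : linear f -> f 0 = 0.
Proof. by move=> hf; rewrite -(scale0r 0) (linZ _ _ hf) scale0r. Qed.
Lemma linN (V W : lmodType F) (f : V -> W) u : linear f -> f (- u) = - f u.
Proof. by move=> hf; rewrite -!scaleN1r linZ. Qed.

Lemma graded_uniq (V : lmodType F) (p : bool -> V -> Prop) u0 u1 v0 v1 :
  graded p -> p false u0 -> p true u1 -> p false v0 -> p true v1 ->
  u0 + u1 = v0 + v1 -> u0 = v0 /\ u1 = v1.
Proof.
move=> gp hu0 hu1 hv0 hv1 e.
have e0 : u0 - v0 = v1 - u1.
  by apply/eqP; rewrite subr_eq addrAC eq_sym subr_eq e addrC.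
have z : u0 - v0 = 0.
  apply: (graded_cap gp); last rewrite e0.
    by apply: subD (graded_sub gp _) _ _ => //; apply: subN (graded_sub gp _) _.
  by apply: subD (graded_sub gp _) _ _ => //; apply: subN (graded_sub gp _) _.
split; first by apply/eqP; rewrite -subr_eq0 z.
by apply/eqP; rewrite eq_sym -subr_eq0 -e0 z.
Qed.

Section Modules.
Variable A : superalg.

(* Homogeneous homomorphisms of parity e. *)
Record homog_hom (M N : smodule A) (e : bool) (f : M -> N) : Prop := HomogHom {
  hh_linear : linear f;
  hh_part : forall b m, sm_part b m -> sm_part (b (+) e) (f m);
  hh_act : forall b a m, sa_part b a ->
    f (sm_act a m) = (-1) ^+ (e && b) *: sm_act a (f m) }.

(* The span of the homogeneous homomorphisms. *)
Definition is_hom (M N : smodule A) (f : M -> N) :=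
  exists f0 f1 : M -> N,
    [/\ homog_hom false f0, homog_hom true f1 & forall m, f m = f0 m + f1 m].

Definition siso (M N : smodule A) :=
  exists e (f : M -> N), homog_hom e f /\ bijective f.

Record graded_submodule (M : smodule A) (p : M -> Prop) : Prop := GradedSubmodule {
  gs_subspace : subspace p;
  gs_act : forall a m, p m -> p (sm_act a m);
  gs_graded : forall m, p m -> exists m0 m1,
    [/\ p m0 /\ sm_part false m0, p m1 /\ sm_part true m1 & m = m0 + m1] }.

Definition simple_module (M : smodule A) :=
  (exists m : M, m <> 0) /\
  forall p : M -> Prop, graded_submodule p ->
    (forall m, p m -> m = 0) \/ (forall m, p m).

Lemma homog_hom_subspace (M N : smodule A) e :
  subspace (@homog_hom M N e : (M -> N) -> Prop).
Proof.
split.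
  split=> [a u v|b m _|b a m _] /=.
  - by rewrite /GRing.zero /= scaler0 addr0.
  - by apply: sub0; apply: graded_sub (sm_graded N) _.
  - by rewrite /GRing.zero /= (lin0 (sm_actr _)) scaler0.
move=> a f g [fl fp fa] [gl gp ga]; split=> [k u v|b m hm|b c m hc] /=.
- rewrite !addrfctE !scalrfctE fl gl !scalerDr !scalerA (mulrC a k).
  by rewrite -!addrA; congr (_ + _); rewrite addrCA.
- have s := graded_sub (sm_graded N) (b (+) e).
  by apply: subD => //; [apply: subZ => //; apply: fp | apply: gp].
- rewrite !addrfctE !scalrfctE (fa b) // (ga b) // sm_actr scalerDr.
  by rewrite !scalerA mulrC.
Qed.

Section HomSpace.
Variables M N : smodule A.

Definition hom_pred : {pred M -> N} := fun f => `[< is_hom f >].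

Lemma hom_predP f : reflect (is_hom f) (f \in hom_pred).
Proof. exact: asboolP. Qed.

Fact hom_submod_closed : submod_closed hom_pred.
Proof.
have s e := homog_hom_subspace M N e.
split.
  apply/hom_predP; exists 0, 0; split; try exact: sub0.
  by move=> m; rewrite /GRing.zero /= addr0.
move=> a f g /hom_predP [f0 [f1 [hf0 hf1 ef]]] /hom_predP [g0 [g1 [hg0 hg1 eg]]].
apply/hom_predP; exists (a *: f0 + g0), (a *: f1 + g1); split.
- exact: (s false).2.
- exact: (s true).2.
- move=> m; rewrite !addrfctE !scalrfctE ef eg scalerDr.
  by rewrite addrACA.
Qed.

HB.instance Definition _ :=
  GRing.isSubmodClosed.Build F (M -> N) hom_pred hom_submod_closed.

Record hom_space := HomSpace { hom_fun : M -> N; _ : hom_fun \in hom_pred }.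

HB.instance Definition _ := [isSub for hom_fun].
HB.instance Definition _ := [Choice of hom_space by <:].
HB.instance Definition _ := [SubChoice_isSubLmodule of hom_space by <:].

Lemma hom_spaceP (f : hom_space) : is_hom (hom_fun f).
Proof. by apply/hom_predP; case: f. Qed.

Definition hom_part (e : bool) (f : hom_space) := homog_hom e (hom_fun f).

Lemma hom_part_graded : graded hom_part.
Proof.
have s e := homog_hom_subspace M N e.
split.
- move=> e; split; first exact: (s e).1.
  by move=> a f g hf hg; apply: (s e).2.
- move=> f; have [f0 [f1 [h0 h1 ef]]] := hom_spaceP f.
  have i0 : f0 \in hom_pred.
    apply/hom_predP; exists f0, 0; split=> //; first exact: sub0.
    by move=> m; rewrite /GRing.zero /= addr0.
  have i1 : f1 \in hom_pred.
    apply/hom_predP; exists 0, f1; split=> //; first exact: sub0.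
    by move=> m; rewrite /GRing.zero /= add0r.
  exists (HomSpace i0), (HomSpace i1); split=> //.
  by apply: val_inj; apply/funext=> m /=; rewrite ef.
- move=> f h0 h1; apply: val_inj; apply/funext=> m /=.
  have [m0 [m1 [p0 p1 ->]]] := graded_sum (sm_graded M) m.
  rewrite (linD _ _ (hh_linear h0)).
  have /= a0 := hh_part h0 p0; have /= a1 := hh_part h0 p1.
  have /= b0 := hh_part h1 p0; have /= b1 := hh_part h1 p1.
  rewrite (graded_cap (sm_graded N) a0 b0) (graded_cap (sm_graded N) b1 a1).
  by rewrite addr0.
Qed.

End HomSpace.

(* Types M and Q, meaningful for simple modules only. *)
Definition typeM (M : smodule A) := has_dim (hom_space M M) 1.
Definition typeQ (M : smodule A) := has_dim (hom_space M M) 2.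

End Modules.

Section Pullback.
Variables (A B : superalg) (h : superhom A B) (M : smodule B).

Fact pullback_actl (m : M) : linear (fun a : A => sm_act (h a) m).
Proof. by move=> k a b; rewrite sh_linear sm_actl. Qed.
Fact pullback_act1 (m : M) : sm_act (h 1) m = m.
Proof. by rewrite (sh_monoid h).1 sm_act1. Qed.
Fact pullback_actM a b (m : M) :
  sm_act (h (a * b)) m = sm_act (h a) (sm_act (h b) m).
Proof. by rewrite (sh_monoid h).2 sm_actM. Qed.
Fact pullback_part b c a (m : M) :
  sa_part b a -> sm_part c m -> sm_part (b (+) c) (sm_act (h a) m).
Proof. by move=> ha; apply: sm_act_part; apply: sh_part. Qed.

Definition pullback : smodule A :=
  SModule (sm_graded M) pullback_actl (fun a => sm_actr (h a))
    pullback_act1 pullback_actM pullback_part.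

End Pullback.

End Super.

Section PresentedSuper.
Variables (F : fieldType) (two_neq0 : 2%:R != 0 :> F) (P : presentation F).
(* The relations respect the parity in which every generator is odd. *)
Hypothesis tneg_cong :
  forall s t, @rels F P s t -> cong (@rels F P) (tneg s) (tneg t).

Lemma cong_tneg (s t : term F (gens P)) :
  cong (@rels F P) s t -> cong (@rels F P) (tneg s) (tneg t).
Proof.
elim=> {s t} /=; last first.
all: try by move=> *; do [exact: cong_constC | exact: cong_constM
  | exact: cong_constD | exact: cong_mulDr | exact: cong_mulDl
  | exact: cong_mul1r | exact: cong_mul1l | exact: cong_mulA
  | exact: cong_addN | exact: cong_add0 | exact: cong_addC | exact: cong_addA
  | exact: cong_mul | exact: cong_add | exact: cong_sym | exact: cong_refl].
- by move=> s t u _ h1 _ h2; apply: cong_trans h1 h2.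
- exact: tneg_cong.
Qed.

Definition palg_part (b : bool) (x : palg P) :=
  exists2 t, thomog b t & x = pcls t.

Lemma thomog_zero_any (X : Type) b : thomog b (@TConst F X 0).
Proof. by case: b; constructor. Qed.

Lemma thomog_scale (X : Type) b a (t : term F X) :
  thomog b t -> thomog b (TMul (TConst a) t).
Proof. by move=> h; apply: (@thomog_mul _ _ false b); first constructor. Qed.

Lemma palg_part_sub b : subspace (palg_part b).
Proof.
split; first by exists (TConst 0); [apply: thomog_zero_any|rewrite pclsC scale0r].
move=> a _ _ [s hs ->] [t ht ->]; exists (TAdd (TMul (TConst a) s) t).
  by apply: thomog_add => //; apply: thomog_scale.
by rewrite pclsD pclsM pclsC mulr_algl.
Qed.

Lemma palg_part1 : palg_part false 1.
Proof. by exists (TConst 1); [constructor | rewrite pclsC scale1r]. Qed.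

Lemma palg_partM b c x y :
  palg_part b x -> palg_part c y -> palg_part (b (+) c) (x * y).
Proof.
move=> [s hs ->] [t ht ->]; exists (TMul s t); last by rewrite pclsM.
exact: thomog_mul.
Qed.

Lemma palg_part_gen x : palg_part true (pgen P x).
Proof. by exists (TVar x); first constructor. Qed.

Lemma thomog_tneg b (t : term F (gens P)) :
  thomog b t -> pcls (P := P) (tneg t) = (-1) ^+ b *: pcls t.
Proof.
elim=> {b t} /=.
- by move=> x; rewrite pclsM pclsC mulr_algl expr1.
- by move=> c; rewrite expr0 scale1r.
- by rewrite expr1 pclsC scale0r scaler0.
- by move=> b s t _ hs _ ht; rewrite !pclsD hs ht scalerDr.
- move=> b c s t _ hs _ ht.
  by rewrite !pclsM hs ht -scalerAl -scalerAr scalerA signr_addb.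
Qed.

Lemma palg_part_cap x : palg_part false x -> palg_part true x -> x = 0.
Proof.
move=> [s hs ->] [t ht e].
have := thomog_tneg hs; rewrite expr0 scale1r => es.
have := thomog_tneg ht; rewrite expr1 scaleN1r -e => et.
have es' : pcls (P := P) (tneg s) = pcls (P := P) (tneg t).
  by apply/pclsP/cong_tneg/pclsP.
have {es et es'} h : pcls s = - pcls s :> palg P by rewrite -{1}es es' et.
have : 2%:R *: (pcls s : palg P) = 0 by rewrite scaler_nat mulr2n {2}h subrr.
move/(congr1 (fun y => (2%:R)^-1 *: y)).
by rewrite scalerA mulVf // scale1r scaler0.
Qed.

Lemma palg_part_sum x :
  exists x0 x1, [/\ palg_part false x0, palg_part true x1 & x = x0 + x1].
Proof.
have z b := sub0 (palg_part_sub b).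
elim/palg_ind: x; elim=> [x|c|s [s0 [s1 [p0 p1 es]]] t [t0 [t1 [q0 q1 et]]]
  |s [s0 [s1 [p0 p1 es]]] t [t0 [t1 [q0 q1 et]]]].
- by exists 0, (pgen P x); split; rewrite ?add0r //; apply: palg_part_gen.
- by exists (pcls (TConst c)), 0; split; rewrite ?addr0 //; exists (TConst c);
    first constructor.
- exists (s0 + t0), (s1 + t1); split; try exact: subD (palg_part_sub _) _ _.
  by rewrite pclsD es et addrACA.
- exists (s0 * t0 + s1 * t1), (s0 * t1 + s1 * t0); split.
  + by apply: subD (palg_part_sub _) (palg_partM p0 q0) (palg_partM p1 q1).
  + by apply: subD (palg_part_sub _) (palg_partM p0 q1) (palg_partM p1 q0).
  + by rewrite pclsM es et mulrDl !mulrDr [s1 * t0 + _]addrC addrACA.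
Qed.

Lemma palg_graded : graded palg_part.
Proof. by split; [exact: palg_part_sub | exact: palg_part_sum
  | exact: palg_part_cap]. Qed.

(* Every generator is odd. *)
Definition psalg : superalg F := SuperAlg palg_graded palg_part1 palg_partM.

Lemma plift_part (B : superalg F) (g : gens P -> B) : respects g ->
  (forall x, sa_part true (g x)) ->
  forall b (x : psalg), sa_part b x -> sa_part b (plift g x).
Proof.
move=> gP g1 b _ [t ht ->]; rewrite plift_cls //.
have s c := graded_sub (sa_graded B) c.
elim: ht => {b t} /=.
- by [].
- by move=> c; apply: subZ => //; apply: sa_part1.
- by rewrite scale0r; apply: sub0.
- by move=> b u v _ hu _ hv; apply: subD.
- by move=> b c u v _ hu _ hv; apply: sa_partM.
Qed.

Definition pshom (B : superalg F) (g : gens P -> B) (gP : respects g)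
    (g1 : forall x, sa_part true (g x)) : superhom psalg B :=
  @SuperHom F psalg B _ (plift_linear gP) (plift_monoid gP) (plift_part gP g1).

Lemma superhom_ext (B : superalg F) (f h : superhom psalg B) :
  (forall x, f (pgen P x) = h (pgen P x)) -> f =1 h.
Proof.
move=> e; elim/palg_ind; elim=> [x|c|s hs t ht|s hs t ht].
- exact: e.
- by rewrite pclsC !(linZ _ _ (sh_linear _)) !(sh_monoid _).1.
- by rewrite pclsD !(linD _ _ (sh_linear _)) hs ht.
- by rewrite pclsM !(sh_monoid _).2 hs ht.
Qed.

Lemma psuper_comm (H : superalg F) (f : superhom psalg H) (z : H) (d : bool) :
  (forall x, z * f (pgen P x) = (-1) ^+ d *: (f (pgen P x) * z)) ->
  forall c x, sa_part c x -> z * f x = (-1) ^+ (d && c) *: (f x * z).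
Proof.
move=> hz c _ [t ht ->]; have fl := sh_linear f; have fm := sh_monoid f.
elim: ht => {c t} [x|a||b s t _ hs _ ht|b c s t _ hs _ ht].
- by rewrite andbT; apply: hz.
- rewrite andbF scale1r pclsC (linZ _ _ fl) fm.1.
  by rewrite -scalerAr -scalerAl mulr1 mul1r.
- by rewrite pclsC scale0r (lin0 fl) mulr0 mul0r scaler0.
- by rewrite pclsD (linD _ _ fl) mulrDr mulrDl hs ht scalerDr.
- rewrite pclsM fm.2 mulrA hs -scalerAl -[f (pcls s) * z * _]mulrA ht.
  rewrite -scalerAr scalerA mulrA.
  by rewrite -signr_addb -andb_addr.
Qed.

End PresentedSuper.

(******************************************************************************)
(* The semidirect product of a superalgebra A by a finite group W acting by   *)
(* superalgebra automorphisms: the sums of a_w w over w in W, with             *)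
(* (a u) (b v) = a u(b) (u v) and W even.                                     *)
(******************************************************************************)

Section Semidirect.
Variables (F : fieldType) (A : superalg F) (W : finGroupType).

Record autact := AutAct {
  aut :> W -> superhom A A;
  aut1 : forall x, aut 1%g x = x;
  autM : forall u v x, aut (u * v)%g x = aut u (aut v x) }.

Definition sdalg (to : autact) : Type := {ffun W -> A}.

Variable to : autact.

HB.instance Definition _ := GRing.Lmodule.copy (sdalg to) {ffun W -> A}.

Definition sdelt (a : A) (w : W) : sdalg to := [ffun v => if v == w then a else 0].

Definition sdmul (f g : sdalg to) : sdalg to :=
  [ffun w => \sum_u f u * to u (g (u^-1 * w)%g)].

Lemma aut_lin u : linear (to u). Proof. exact: sh_linear. Qed.
Lemma autMr u x y : to u (x * y) = to u x * to u y.
Proof. exact: (sh_monoid (to u)).2. Qed.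
Lemma aut_sum u (I : finType) (G : I -> A) : to u (\sum_i G i) = \sum_i to u (G i).
Proof.
apply: (big_morph (to u)); first by move=> x y; apply: linD (aut_lin u).
exact: lin0 (aut_lin u).
Qed.

Fact sdmulA : associative sdmul.
Proof.
move=> f g h; apply/ffunP=> w; rewrite !ffunE.
under eq_bigr => u _ do rewrite ffunE aut_sum mulr_sumr.
under [RHS]eq_bigr => u _ do rewrite ffunE mulr_suml.
rewrite [RHS]exchange_big /=; apply: eq_bigr => u _.
rewrite [RHS](reindex_inj (mulgI u)) /=; apply: eq_bigr => v _.
by rewrite autMr mulrA -autM mulKg invMg mulgA.
Qed.

Fact sdmul1 : left_id (sdelt 1 1%g) sdmul.
Proof.
move=> f; apply/ffunP=> w; rewrite ffunE (bigD1 1%g) //= big1 ?addr0.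
  by rewrite ffunE eqxx mul1r aut1 invg1 mul1g.
by move=> u /negPf hu; rewrite ffunE hu mul0r.
Qed.

Fact sdmulr1 : right_id (sdelt 1 1%g) sdmul.
Proof.
move=> f; apply/ffunP=> w; rewrite ffunE (bigD1 w) //= big1 ?addr0.
  by rewrite ffunE mulVg eqxx (sh_monoid (to w)).1 mulr1.
move=> u hu; rewrite ffunE; case: eqP => [e|_]; last first.
  by rewrite (lin0 (aut_lin u)) mulr0.
by case/eqP: hu; rewrite -[w](mulKVg u) e mulg1.
Qed.

Fact sdmulDl : left_distributive sdmul +%R.
Proof.
move=> f g h; apply/ffunP=> w; rewrite !ffunE -big_split /=.
by apply: eq_bigr => u _; rewrite ffunE mulrDl.
Qed.

Fact sdmulDr : right_distributive sdmul +%R.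
Proof.
move=> f g h; apply/ffunP=> w; rewrite !ffunE -big_split /=.
by apply: eq_bigr => u _; rewrite ffunE (linD _ _ (aut_lin u)) mulrDr.
Qed.

Fact sdone_neq0 : sdelt 1 1%g != 0.
Proof.
apply/eqP=> /ffunP /(_ 1%g) /eqP; rewrite !ffunE eqxx.
exact/negP/oner_neq0.
Qed.

HB.instance Definition _ := GRing.Zmodule_isNzRing.Build (sdalg to)
  sdmulA sdmul1 sdmulr1 sdmulDl sdmulDr sdone_neq0.

Fact sdscaleAl (a : F) (f g : sdalg to) : a *: (f * g) = (a *: f) * g.
Proof.
apply/ffunP=> w; rewrite !ffunE scaler_sumr; apply: eq_bigr => u _.
by rewrite ffunE scalerAl.
Qed.
HB.instance Definition _ := GRing.Lmodule_isLalgebra.Build F (sdalg to) sdscaleAl.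

Fact sdscaleAr (a : F) (f g : sdalg to) : a *: (f * g) = f * (a *: g).
Proof.
apply/ffunP=> w; rewrite !ffunE scaler_sumr; apply: eq_bigr => u _.
by rewrite ffunE (linZ _ _ (aut_lin u)) scalerAr.
Qed.
HB.instance Definition _ := GRing.Lalgebra_isAlgebra.Build F (sdalg to) sdscaleAr.

Definition sdpart (b : bool) (f : sdalg to) := forall w, sa_part b (f w).

Fact sdpart_graded : graded sdpart.
Proof.
have s b := graded_sub (sa_graded A) b.
split.
- move=> b; split=> [w|a f g hf hg w]; rewrite !ffunE; first exact: sub0.
  by apply: subD => //; apply: subZ.
- move=> f.
  have /boolp.choice [p hp] : forall w, exists p : A * A,
      [/\ sa_part false p.1, sa_part true p.2 & f w = p.1 + p.2].
    move=> w; have [x0 [x1 h]] := graded_sum (sa_graded A) (f w).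
    by exists (x0, x1).
  exists [ffun w => (p w).1], [ffun w => (p w).2]; split.
  + by move=> w; rewrite ffunE; case: (hp w).
  + by move=> w; rewrite ffunE; case: (hp w).
  + by apply/ffunP=> w; rewrite !ffunE; case: (hp w).
- move=> f h0 h1; apply/ffunP=> w; rewrite [RHS]ffunE.
  exact: graded_cap (sa_graded A) _ (h0 w) (h1 w).
Qed.

Lemma sdpart_elt b a w : sa_part b a -> sdpart b (sdelt a w).
Proof.
move=> h v; rewrite ffunE; case: eqP => // _.
exact: sub0 (graded_sub (sa_graded A) b).
Qed.

Fact sdpart1 : sdpart false 1.
Proof. exact/sdpart_elt/sa_part1. Qed.

Fact sdpartM b c f g : sdpart b f -> sdpart c g -> sdpart (b (+) c) (f * g).
Proof.
move=> hf hg w; rewrite ffunE.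
have s := graded_sub (sa_graded A) (b (+) c).
apply: (big_ind (sa_part (b (+) c))).
- exact: sub0.
- by move=> x y; apply: subD.
- by move=> u _; apply: sa_partM => //; apply: sh_part.
Qed.

Definition sdsalg : superalg F := SuperAlg sdpart_graded sdpart1 sdpartM.

Lemma sdeltM a b u v : sdelt a u * sdelt b v = sdelt (a * to u b) (u * v)%g.
Proof.
apply/ffunP=> w; rewrite !ffunE (bigD1 u) //= big1 ?addr0 => [|x /negPf hx].
  rewrite !ffunE eqxx -(inj_eq (mulgI u)) mulKVg.
  by case: eqP => // _; rewrite (lin0 (aut_lin u)) mulr0.
by rewrite ffunE hx mul0r.
Qed.

Lemma sdelt_linear w : linear (sdelt^~ w).
Proof.
move=> a x y; apply/ffunP=> v; rewrite !ffunE.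
by case: eqP => // _; rewrite scaler0 addr0.
Qed.

Fact sd_emb_monoid : monoid_morphism (sdelt^~ 1%g : A -> sdalg to).
Proof. by split=> // x y; rewrite sdeltM aut1 mulg1. Qed.

Definition sd_emb : superhom A sdsalg :=
  @SuperHom F A sdsalg _ (sdelt_linear 1%g) sd_emb_monoid
    (fun b x (hx : sa_part b x) => sdpart_elt 1%g hx).

(* A as a module: A acts by left multiplication, W by automorphisms. *)
Definition sdact (f : sdalg to) (x : A) : A := \sum_w f w * to w x.

Fact sdact_linl x : linear (sdact^~ x).
Proof.
move=> a f g; rewrite /sdact scaler_sumr -big_split /=; apply: eq_bigr => w _.
by rewrite !ffunE mulrDl scalerAl.
Qed.
Fact sdact_linr f : linear (sdact f).
Proof.
move=> a x y; rewrite /sdact scaler_sumr -big_split /=; apply: eq_bigr => w _.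
by rewrite (aut_lin w) mulrDr scalerAr.
Qed.
Lemma sdact_elt a w x : sdact (sdelt a w) x = a * to w x.
Proof.
rewrite /sdact (bigD1 w) //= big1 ?addr0 => [|v /negPf hv]; rewrite ffunE ?eqxx //.
by rewrite hv mul0r.
Qed.
Fact sdact1 x : sdact 1 x = x.
Proof. by rewrite sdact_elt aut1 mul1r. Qed.
Fact sdactM f g x : sdact (f * g) x = sdact f (sdact g x).
Proof.
rewrite /sdact.
under eq_bigr => w _ do rewrite ffunE mulr_suml.
rewrite exchange_big /=; apply: eq_bigr => u _.
rewrite aut_sum mulr_sumr (reindex_inj (mulgI u)) /=; apply: eq_bigr => v _.
by rewrite mulKg autMr autM mulrA.
Qed.
Fact sdact_part b c f x :
  sdpart b f -> sa_part c x -> sa_part (b (+) c) (sdact f x).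
Proof.
move=> hf hx; have s := graded_sub (sa_graded A) (b (+) c).
apply: (big_ind (sa_part (b (+) c))).
- exact: sub0.
- by move=> y z; apply: subD.
- by move=> u _; apply: sa_partM => //; apply: sh_part.
Qed.

Definition sdmodule : smodule sdsalg :=
  @SModule F sdsalg A (@sa_part F A) sdact (sa_graded A) sdact_linl sdact_linr
    sdact1 sdactM sdact_part.

End Semidirect.

(******************************************************************************)
(* Hom_A(U, N) as a B-module, (b f)(u) = psi(b) f(u), where A and B map to H  *)
(* with supercommuting images and N is an H-module.                           *)
(******************************************************************************)

Section HomModule.
Variables (F : fieldType) (A B H : superalg F).
Variables (emb : superhom A H) (psi : superhom B H).
Hypothesis psiC : forall b c (y : B) (x : A), sa_part b y -> sa_part c x ->
  psi y * emb x = (-1) ^+ (b && c) *: (emb x * psi y).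
Variables (U : smodule A) (N : smodule H).

Local Notation NA := (pullback emb N).

Lemma hommod_homog e b (y : B) (f : U -> N) :
  sa_part b y -> @homog_hom F A U NA e f ->
  @homog_hom F A U NA (b (+) e) (fun u => sm_act (psi y) (f u)).
Proof.
move=> hy [fl fp fa]; split=> [a u v|c u hu|c x u hx] /=.
- by rewrite fl (sm_actr (psi y)).
- by rewrite addbCA; apply: sm_act_part; [apply: sh_part | apply: fp].
- rewrite (fa c) //= (linZ _ _ (sm_actr _)) -!sm_actM (psiC hy hx).
  rewrite (linZ _ _ (sm_actl _)) scalerA -signr_addb; congr (_ ^+ _ *: _).
  by case: (e) (b) (c) => [] [] [].
Qed.

Lemma hommod_closed (y : B) (f : hom_space U NA) :
  (fun u => sm_act (psi y) (hom_fun f u) : NA) \in @hom_pred F A U NA.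
Proof.
have [f0 [f1 [h0 h1 ef]]] := hom_spaceP f.
have [y0 [y1 [p0 p1 ->]]] := graded_sum (sa_graded B) y.
have s e := homog_hom_subspace U NA e.
apply/hom_predP.
exists ((fun u => sm_act (psi y0) (f0 u)) + (fun u => sm_act (psi y1) (f1 u))),
       ((fun u => sm_act (psi y0) (f1 u)) + (fun u => sm_act (psi y1) (f0 u))).
split.
- by apply: subD (s _) _ _; [apply: (hommod_homog p0 h0) | apply: (hommod_homog p1 h1)].
- by apply: subD (s _) _ _; [apply: (hommod_homog p0 h1) | apply: (hommod_homog p1 h0)].
- move=> u; rewrite ef !addrfctE (linD _ _ (sh_linear psi)).
  rewrite (linD _ _ (sm_actl _)) !(linD _ _ (sm_actr _)).
  by rewrite [X in _ + X = _]addrC addrACA.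
Qed.

Definition hommod_act (y : B) (f : hom_space U NA) : hom_space U NA :=
  HomSpace (hommod_closed y f).

Fact hommod_actl f : linear (hommod_act^~ f).
Proof.
move=> a x y; apply: val_inj; apply/funext=> u /=.
by rewrite sh_linear sm_actl.
Qed.
Fact hommod_actr y : linear (hommod_act y).
Proof.
move=> a f g; apply: val_inj; apply/funext=> u /=.
by rewrite sm_actr.
Qed.
Fact hommod_act1 f : hommod_act 1 f = f.
Proof.
by apply: val_inj; apply/funext=> u /=; rewrite (sh_monoid psi).1 sm_act1.
Qed.
Fact hommod_actM x y f : hommod_act (x * y) f = hommod_act x (hommod_act y f).
Proof.
by apply: val_inj; apply/funext=> u /=; rewrite (sh_monoid psi).2 sm_actM.
Qed.
Fact hommod_act_part b e y f : sa_part b y -> @hom_part F A U NA e f ->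
  @hom_part F A U NA (b (+) e) (hommod_act y f).
Proof. by move=> hy hf; apply: hommod_homog hy hf. Qed.

Definition hommod : smodule B :=
  @SModule F B (hom_space U NA) (@hom_part F A U NA) hommod_act
    (hom_part_graded U NA) hommod_actl hommod_actr hommod_act1 hommod_actM
    hommod_act_part.

End HomModule.

(******************************************************************************)
(* The Clifford superalgebra of 'cV[F]_n with the standard symmetric bilinear *)
(* form: v w + w v = 2 (v, w).                                                *)
(******************************************************************************)

Definition dotp (F : nzRingType) n (v w : 'cV[F]_n) : F := (v^T *m w) 0 0.

Section Clifford.
Variables (F : fieldType) (n : nat).

Inductive cliff_rel : term F 'cV[F]_n -> term F 'cV[F]_n -> Prop :=
| cliff_lin a u v :
    cliff_rel (TVar (a *: u + v)) (TAdd (TMul (TConst a) (TVar u)) (TVar v))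
| cliff_dot v w :
    cliff_rel (TAdd (TMul (TVar v) (TVar w)) (TMul (TVar w) (TVar v)))
              (TConst (2%:R * dotp v w)).

(* The action on functions of subsets (a spin representation) that shows that *)
(* the Clifford algebra is nonzero.                                           *)
Let M := {ffun {set 'I_n} -> F^o}.
Let flip (i : 'I_n) (S : {set 'I_n}) := [set j | (j \in S) (+) (j == i)].
Let sgn (i : 'I_n) (S : {set 'I_n}) : F := \prod_(k : 'I_n | (k < i)%N) (-1) ^+ (k \in S).
Let gam (v : 'cV[F]_n) (f : M) : M :=
  [ffun S => \sum_i v i 0 * sgn i S * f (flip i S)].

Let sgn_flip i j S : sgn i (flip j S) = (-1) ^+ (j < i)%N * sgn i S.
Proof.
rewrite /sgn; under eq_bigr => k _ do rewrite inE signr_addb.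
rewrite big_split /= mulrC; congr (_ * _).
case: (ltnP j i) => h.
  rewrite (bigD1 j) //= eqxx big1 ?mulr1 // => k /andP[_ /negPf ->].
  by rewrite expr0.
apply: big1 => k hk; case: eqP => // e.
by move: hk; rewrite e ltnNge h.
Qed.

Let flipC i j S : flip i (flip j S) = flip j (flip i S).
Proof. by apply/setP=> k; rewrite !inE -!addbA; congr (_ (+) _); rewrite addbC. Qed.

Let flipK i S : flip i (flip i S) = S.
Proof. by apply/setP=> k; rewrite !inE -addbA addbb addbF. Qed.

Let sgn2 i S : sgn i S * sgn i S = 1.
Proof.
rewrite /sgn -big_split /=; apply: big1 => k _.
by rewrite -expr2 sqrr_sign.
Qed.

Let gam_gam v w f S : gam v (gam w f) S =
  \sum_i \sum_j v i 0 * w j 0 * (sgn i S * sgn j (flip i S)) * f (flip j (flip i S)).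
Proof.
rewrite ffunE; apply: eq_bigr => i _; rewrite ffunE mulr_sumr.
by apply: eq_bigr => j _; rewrite !mulrA; congr (_ * _ * _); rewrite mulrAC.
Qed.

Let gam_rel s t : cliff_rel s t -> tact gam s =1 tact gam t.
Proof.
case=> {s t} /= [a u v|v w] f; apply/ffunP=> S.
  rewrite !ffunE /= scaler_sumr -big_split /=; apply: eq_bigr => i _.
  by rewrite !mxE !mulrDl /GRing.scale /= !mulrA.
rewrite ffunE !gam_gam [X in _ + X]exchange_big -big_split /=.
rewrite [RHS]ffunE /dotp mxE mulr_sumr scaler_suml; apply: eq_bigr => i _.
rewrite -big_split (bigD1 i) //= big1 ?addr0 => [|j hj].
  rewrite !flipK !sgn_flip ltnn mul1r sgn2 !mxE.
  move: (f S) => z; rewrite /GRing.scale /=; ring.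
rewrite (flipC j i) !sgn_flip; move: (f _) => z.
case: (ltngtP i j) => h; rewrite ?expr0 ?expr1; first by ring.
  by ring.
by case/eqP: hj; apply/val_inj.
Qed.

Lemma cliff_nontrivial : ~ cong cliff_rel (TConst 1) (TConst 0).
Proof.
have gamL v : linear (gam v).
  move=> a f g; apply/ffunP=> S; rewrite !ffunE scaler_sumr -big_split /=.
  by apply: eq_bigr => i _; rewrite !ffunE mulrDr /GRing.scale /= mulrCA.
move=> /(tact_cong gamL gam_rel) /= /(_ [ffun _ => 1]) /ffunP /(_ set0) /eqP.
by rewrite !ffunE scale1r scale0r; exact/negP/oner_neq0.
Qed.

Definition cliff_pres : presentation F := Presentation cliff_nontrivial.

Lemma cliff_genE (v w : 'cV[F]_n) :
  pgen cliff_pres v * pgen cliff_pres w + pgen cliff_pres w * pgen cliff_pres v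
  = (2%:R * dotp v w)%:A.
Proof.
rewrite -pclsC /pgen -!pclsM -pclsD; apply/pclsP.
exact: (cong_rel (cliff_dot v w)).
Qed.

Lemma cliff_gen_linear : linear (pgen cliff_pres : 'cV[F]_n -> palg cliff_pres).
Proof.
move=> a u v; rewrite -mulr_algl -pclsC /pgen -pclsM -pclsD; apply/pclsP.
exact: (cong_rel (cliff_lin a u v)).
Qed.

Lemma cliff_tneg s t : cliff_rel s t -> cong cliff_rel (tneg s) (tneg t).
Proof.
move=> h; apply/(@pclsP F cliff_pres); case: h => {s t} [a u v|v w] /=.
  rewrite !(pclsM, pclsD) !pclsC.
  rewrite -[@pcls F cliff_pres (TVar (a *: u + v))]/(pgen cliff_pres (a *: u + v)).
  rewrite cliff_gen_linear !mulr_algl scalerDr !scalerA.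
  by rewrite [-1 * a]mulrC.
rewrite !(pclsM, pclsD) !pclsC !mulr_algl -!scalerAl -!scalerAr !scalerA.
by rewrite mulrNN mulr1 !scale1r cliff_genE.
Qed.

Hypothesis two_neq0 : 2%:R != 0 :> F.

Definition clifford : superalg F := @psalg F two_neq0 cliff_pres cliff_tneg.

Definition cliff_iota (v : 'cV[F]_n) : clifford := pgen cliff_pres v.

Lemma cliff_map_respects (g : 'M[F]_n) : g^T *m g = 1%:M ->
  @respects F cliff_pres clifford (fun v => cliff_iota (g *m v)).
Proof.
move=> hg _ _ [a u v|v w] /=.
  by rewrite mulmxDr -scalemxAr /cliff_iota cliff_gen_linear mulr_algl.
rewrite /cliff_iota cliff_genE; congr (_ * _)%:A.
by rewrite /dotp trmx_mul mulmxA -(mulmxA v^T) hg mulmx1.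
Qed.

(* The automorphism induced by an orthogonal transformation. *)
Definition cliff_map (g : 'M[F]_n) (hg : g^T *m g = 1%:M) :
    superhom clifford clifford :=
  @pshom F two_neq0 cliff_pres cliff_tneg clifford _ (cliff_map_respects hg)
    (fun v => palg_part_gen (P := cliff_pres) (g *m v)).

Lemma cliff_mapE g hg v : @cliff_map g hg (cliff_iota v) = cliff_iota (g *m v).
Proof. by rewrite /= plift_gen //; apply: cliff_map_respects. Qed.

Lemma cliff_ext (B : superalg F) (f h : superhom clifford B) :
  (forall v, f (cliff_iota v) = h (cliff_iota v)) -> f =1 h.
Proof. exact: (@superhom_ext F two_neq0 cliff_pres cliff_tneg B f h). Qed.

End Clifford.

Section RootSystems.
Variables (R : realType) (n : nat).
Implicit Types (Phi : seq 'cV[R]_n) (a b v : 'cV[R]_n).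

Definition reflection a v := v - (2%:R * dotp a v / dotp a a) *: a.

Record root_system Phi : Prop := RootSystem {
  root_neq0 : 0 \notin Phi;
  root_span : <<Phi>>%VS = fullv;
  root_reduced : forall a c, a \in Phi -> c *: a \in Phi -> c = 1 \/ c = -1;
  root_refl : forall a b, a \in Phi -> b \in Phi -> reflection a b \in Phi;
  root_int : forall a b, a \in Phi -> b \in Phi ->
    2%:R * dotp a b / dotp a a \is a Num.int }.

(* Nonempty, and not the union of two nonempty orthogonal subsets. *)
Definition irreducible_roots Phi :=
  Phi <> [::] /\
  forall P : pred 'cV[R]_n,
    (exists2 a, a \in Phi & P a) -> (exists2 b, b \in Phi & ~~ P b) ->
    exists a b, [/\ a \in Phi /\ P a, b \in Phi /\ ~~ P b & dotp a b != 0].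

Definition simple_system Phi (alpha : n.-tuple 'cV[R]_n) :=
  [/\ {subset alpha <= Phi}, basis_of fullv alpha &
      forall b, b \in Phi -> exists c : 'I_n -> nat,
        b = \sum_i (c i)%:R *: tnth alpha i \/
        b = - (\sum_i (c i)%:R *: tnth alpha i)].

End RootSystems.

(* An irreducible finite Weyl group: a finite group W with a faithful         *)
(* representation (acting on column vectors) on the Euclidean space R^rank in *)
(* which it is generated by the reflections s_i in a system of simple roots   *)
(* of an irreducible crystallographic root system.                            *)
Record weyl_group (R : realType) := WeylGroup {
  rank : nat;
  wgroup : finGroupType;
  wrep : mx_representation R [set: wgroup] rank;
  roots : seq 'cV[R]_rank;
  sroot : rank.-tuple 'cV[R]_rank;
  srefl : 'I_rank -> wgroup;
  roots_system : root_system roots;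
  roots_irr : irreducible_roots roots;
  sroot_simple : simple_system roots sroot;
  wrep_faithful : mx_faithful wrep;
  wrep_refl : forall i v, wrep (srefl i) *m v = reflection (tnth sroot i) v;
  srefl_gen : <<[set srefl i | i : 'I_rank]>>%g = [set: wgroup] }.

Section WeylFacts.
Variables (R : realType) (W : weyl_group R).
Local Notation n := (rank W).
Local Notation rho := (wrep W).
Local Notation s := (@srefl R W).
Local Notation al := (tnth (sroot W)).
Implicit Types (u v : 'cV[R]_n).

Definition coxm (i j : 'I_n) : nat := #[s i * s j]%g.

Lemma dotpC u v : dotp u v = dotp v u.
Proof. by rewrite /dotp !mxE; apply: eq_bigr => k _; rewrite !mxE mulrC. Qed.
Lemma dotpDr u v w : dotp u (v + w) = dotp u v + dotp u w.
Proof. by rewrite /dotp mulmxDr mxE. Qed.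
Lemma dotpZr a u v : dotp u (a *: v) = a * dotp u v.
Proof. by rewrite /dotp -scalemxAr mxE. Qed.
Lemma dotpDl u v w : dotp (u + v) w = dotp u w + dotp v w.
Proof. by rewrite dotpC dotpDr dotpC [dotp w v]dotpC. Qed.
Lemma dotpZl a u v : dotp (a *: u) v = a * dotp u v.
Proof. by rewrite dotpC dotpZr dotpC. Qed.
Lemma dotpNr u v : dotp u (- v) = - dotp u v.
Proof. by rewrite -scaleN1r dotpZr mulN1r. Qed.
Lemma dotpNl u v : dotp (- u) v = - dotp u v.
Proof. by rewrite -scaleN1r dotpZl mulN1r. Qed.
Definition dotpE := (dotpDr, dotpDl, dotpZr, dotpZl, dotpNr, dotpNl).

Lemma dotp_ge0 u : 0 <= dotp u u.
Proof.
by rewrite /dotp mxE sumr_ge0 // => k _; rewrite mxE -expr2 sqr_ge0.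
Qed.
Lemma dotp_gt0 u : u != 0 -> 0 < dotp u u.
Proof.
move=> h; rewrite lt_def dotp_ge0 andbT; apply: contraNneq h => h.
apply/eqP/matrixP=> i j; rewrite ord1 mxE; apply/eqP.
rewrite -sqrf_eq0 eq_le sqr_ge0 andbT -h /dotp mxE (bigD1 i) //= mxE -expr2.
by rewrite lerDl sumr_ge0 // => k _; rewrite mxE -expr2 sqr_ge0.
Qed.

Lemma al_in i : al i \in roots W.
Proof. by case: (sroot_simple W) => h _ _; apply: h; apply: mem_tnth. Qed.
Lemma al_neq0 i : al i != 0.
Proof. by apply: contraNneq (root_neq0 (roots_system W)) => <-; apply: al_in. Qed.
Lemma al_gt0 i : 0 < dotp (al i) (al i).
Proof. exact/dotp_gt0/al_neq0. Qed.

Lemma al_coord i j : coord (sroot W) j (al i) = (i == j)%:R.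
Proof.
have [_ /basis_free hf _] := sroot_simple W.
by rewrite (tnth_nth 0) coord_free // eq_sym.
Qed.

Lemma dotp_le0 i j : i != j -> dotp (al i) (al j) <= 0.
Proof.
move=> hij; have [_ _ hs] := sroot_simple W.
have hr := root_refl (roots_system W) (al_in j) (al_in i).
have [c hc] := hs _ hr; have g := al_gt0 j.
set p := 2%:R * dotp (al j) (al i) / dotp (al j) (al j) in hr hc.
have co k : coord (sroot W) k (\sum_l (c l)%:R *: al l) = (c k)%:R.
  rewrite linear_sum (bigD1 k) //= big1 => [|l /negPf hl].
    by rewrite linearZ /= al_coord eqxx addr0 mulr1.
  by rewrite linearZ /= al_coord hl mulr0.
have hp : p <= 0.
  case: hc => hc.
    have := etrans (congr1 (coord (sroot W) j) hc) (co j).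
    rewrite /reflection -/p linearB linearZ /= !al_coord eqxx (negPf hij) mulr1 sub0r => h.
    by rewrite -oppr_ge0 h ler0n.
  have := congr1 (coord (sroot W) i) hc; rewrite linearN.
  move/(fun e => etrans e (congr1 -%R (co i))); rewrite /reflection -/p.
  rewrite linearB linearZ /= !al_coord eqxx eq_sym (negPf hij) mulr0 subr0.
  move/eqP; rewrite -subr_eq0 opprK -[1]/(1%:R) -natrD pnatr_eq0 //.
move: hp; rewrite /p pmulr_lle0 ?invr_gt0 // pmulr_rle0 ?ltr0n //.
by rewrite dotpC.
Qed.

Lemma cartan_nat i j : i != j -> exists2 k : nat, (k < 4)%N &
  4%:R * dotp (al i) (al j) ^+ 2 = k%:R * (dotp (al i) (al i) * dotp (al j) (al j)).
Proof.
move=> hij; set a := al i; set b := al j.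
have ga : 0 < dotp a a := al_gt0 i; have gb : 0 < dotp b b := al_gt0 j.
have hi := root_int (roots_system W) (al_in i) (al_in j).
have hj := root_int (roots_system W) (al_in j) (al_in i).
have := rpredM hi hj; rewrite -/a -/b [dotp b a]dotpC.
set K := _ * _ => hK.
have eK : K * (dotp a a * dotp b b) = 4%:R * dotp a b ^+ 2.
  by rewrite /K; field; rewrite !gt_eqF.
have K0 : 0 <= K.
  rewrite -(pmulr_lge0 _ (mulr_gt0 ga gb)) eK.
  by rewrite mulr_ge0 ?ler0n ?sqr_ge0.
have /natrP [k hk] : K \is a Num.nat by rewrite natrEint hK K0.
exists k; last by rewrite -eK hk.
rewrite -(ltr_nat R) -hk -(ltr_pM2r (mulr_gt0 ga gb)) eK ltr_pM2l ?ltr0n //.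
have : 0 < dotp (dotp b b *: a - dotp a b *: b) (dotp b b *: a - dotp a b *: b).
  apply: dotp_gt0; apply/eqP=> /(congr1 (coord (sroot W) i)).
  rewrite linear0 linearB !linearZ /= !al_coord eqxx eq_sym (negPf hij) mulr0.
  by rewrite subr0 mulr1 => /eqP; rewrite gt_eqF.
rewrite !dotpE [dotp b a]dotpC.
rewrite [X in 0 < X](_ : _ = dotp b b * (dotp a a * dotp b b - dotp a b ^+ 2));
  last by ring.
by rewrite pmulr_rgt0 // subr_gt0.
Qed.

Lemma wrepM x y : rho (x * y)%g = rho x *m rho y.
Proof. by rewrite repr_mxM ?inE. Qed.
Lemma wrep1 : rho 1%g = 1%:M.
Proof. exact: repr_mx1. Qed.
Lemma wrep_inj : injective rho.
Proof. by move=> x y h; apply: (mx_faithful_inj (wrep_faithful W)) h; rewrite inE. Qed.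

Lemma wrep_iter x k v : rho (x ^+ k)%g *m v = iter k (fun u => rho x *m u) v.
Proof.
elim: k => [|k IH] /=; first by rewrite expg0 wrep1 mul1mx.
by rewrite expgS wrepM -mulmxA IH.
Qed.

Lemma wrep_ext x y : (forall v, rho x *m v = rho y *m v) -> x = y.
Proof.
move=> h; apply: wrep_inj; apply/matrixP=> i j.
have := h (delta_mx j 0); rewrite -!colE => /matrixP /(_ i 0).
by rewrite !mxE.
Qed.

Lemma dotp_refl (a u v : 'cV[R]_n) : a != 0 ->
  dotp (reflection a u) (reflection a v) = dotp u v.
Proof.
move=> /dotp_gt0 ha; rewrite /reflection !dotpE (dotpC u a).
by field; rewrite gt_eqF.
Qed.

Lemma dotp_mull (M : 'M[R]_n) u v : dotp (M *m u) v = dotp u (M^T *m v).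
Proof. by rewrite /dotp trmx_mul mulmxA. Qed.

Lemma dotp_delta (M : 'M[R]_n) k l :
  dotp (delta_mx k 0) (M *m delta_mx l 0) = M k l.
Proof. by rewrite /dotp trmx_delta -rowE -colE !mxE. Qed.

Lemma wrep_orth x : (rho x)^T *m rho x = 1%:M.
Proof.
pose G := [set x | (rho x)^T *m rho x == 1%:M].
have gG : group_set G.
  apply/group_setP; split=> [|y z]; rewrite !inE.
    by rewrite wrep1 trmx1 mulmx1.
  move=> /eqP hy /eqP hz; rewrite wrepM trmx_mul mulmxA -(mulmxA (rho z)^T) hy.
  by rewrite mulmx1 hz.
have : <<[set s i | i : 'I_n]>>%g \subset Group gG.
  rewrite gen_subG; apply/subsetP=> _ /imsetP [i _ ->]; rewrite inE.
  apply/eqP/matrixP=> k l.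
  have := dotp_refl (delta_mx k 0) (delta_mx l 0) (al_neq0 i).
  rewrite -!wrep_refl dotp_mull mulmxA -[X in _ = dotp _ X]mul1mx.
  by rewrite !dotp_delta.
rewrite srefl_gen => /subsetP /(_ x); rewrite !inE => /(_ isT).
by move/eqP.
Qed.

Lemma srefl_neq1 i : s i != 1%g.
Proof.
apply/eqP=> h; have := wrep_refl i (al i); rewrite h wrep1 mul1mx /reflection.
rewrite mulfK ?gt_eqF ?al_gt0 // => /eqP.
rewrite eq_sym addrC -subr_eq0 addrK oppr_eq0 scaler_eq0 pnatr_eq0 /=.
by rewrite (negPf (al_neq0 i)).
Qed.

Lemma reflectionK (a v : 'cV[R]_n) : a != 0 -> reflection a (reflection a v) = v.
Proof.
move=> /dotp_gt0 ha; rewrite {1}/reflection /reflection !dotpE -addrA -opprD -scalerDl.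
rewrite [X in X *: a](_ : _ = 0) ?scale0r ?subr0 //.
by field; rewrite gt_eqF.
Qed.

Lemma srefl2 i : (s i * s i = 1)%g.
Proof.
apply: wrep_ext => v.
by rewrite wrepM -mulmxA !wrep_refl reflectionK ?al_neq0 // wrep1 mul1mx.
Qed.

Lemma coxmii i : coxm i i = 1%N.
Proof. by rewrite /coxm srefl2 order1. Qed.

Section CoxeterOrder.
Variables (i j : 'I_n) (k : nat).
Hypotheses (hij : i != j) (k4 : (k < 4)%N).
Let a := al i.
Let b := al j.
Hypothesis hk : 4%:R * dotp a b ^+ 2 = k%:R * (dotp a a * dotp b b).
Let f v : R := 2%:R * dotp a v / dotp a a.
Let g v : R := 2%:R * dotp b v / dotp b b.
Let p := g a.
Let q := f b.
Let ga : dotp a a != 0. Proof. by rewrite gt_eqF ?al_gt0. Qed.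
Let gb : dotp b b != 0. Proof. by rewrite gt_eqF ?al_gt0. Qed.
Let w := (s i * s j)%g.

Let pq : p * q = k%:R.
Proof.
apply: (mulIf ga); apply: (mulIf gb); rewrite -[RHS]mulrA -hk /p /q /f /g.
by rewrite [dotp b a]dotpC; field; rewrite ga gb.
Qed.

Let step (fv gv : R) (xy : R * R) : R * R :=
  (xy.1 - ((fv + 2%:R * xy.1 + q * xy.2) - q * (gv + p * xy.1 + 2%:R * xy.2)),
   xy.2 - (gv + p * xy.1 + 2%:R * xy.2)).

Let wE xy v : rho w *m (v + xy.1 *: a + xy.2 *: b) =
  let xy' := step (f v) (g v) xy in v + xy'.1 *: a + xy'.2 *: b.
Proof.
rewrite wrepM -mulmxA !wrep_refl -/a -/b /reflection /=.
set u := v + _ + _.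
have gu : 2%:R * dotp b u / dotp b b = g v + p * xy.1 + 2%:R * xy.2.
  by rewrite /u !dotpE /g /p /g; field; rewrite gb.
rewrite gu; set G := g v + _ + _.
have -> : 2%:R * dotp a (u - G *: b) / dotp a a =
    (f v + 2%:R * xy.1 + q * xy.2) - q * G.
  by rewrite /u !dotpE /f /q /f; field; rewrite ga.
set K := _ - q * G.
rewrite /u !scalerBl -!addrA; congr (_ + (_ + _)).
by rewrite addrA addrC.
Qed.

Let wX m v : rho (w ^+ m)%g *m v =
  let xy := iter m (step (f v) (g v)) (0, 0) in v + xy.1 *: a + xy.2 *: b.
Proof.
rewrite wrep_iter; elim: m => [|m IH] /=; first by rewrite !scale0r !addr0.
by rewrite IH wE.
Qed.

Let w1 m : (forall fv gv, iter m (step fv gv) (0, 0) = (0, 0)) -> (w ^+ m = 1)%g.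
Proof.
move=> h; apply: wrep_ext => v.
by rewrite wX h wrep1 mul1mx /= !scale0r !addr0.
Qed.

Let wn1 m : (iter m (step q 2%:R) (0, 0)).2 != 0 -> (w ^+ m != 1)%g.
Proof.
move=> h; apply: contraNneq h => h; have := wX m b.
have -> : g b = 2%:R by rewrite /g mulfK.
rewrite -/q h wrep1 mul1mx /= => /(congr1 (coord (sroot W) j)).
rewrite !linearD !linearZ /= !al_coord eqxx (negPf hij) mulr0 mulr1 addr0.
by move/eqP; rewrite -subr_eq0 opprD addrA subrr sub0r oppr_eq0.
Qed.

Let ord m : (0 < m)%N -> (w ^+ m = 1)%g ->
  (forall d, (d < m)%N -> (0 < d)%N -> (d %| m)%N -> (w ^+ d != 1)%g) -> coxm i j = m.
Proof.
move=> m0 /eqP; rewrite -order_dvdn => hd h; rewrite /coxm -/w.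
have := dvdn_leq m0 hd; rewrite leq_eqVlt => /orP [/eqP //|hl].
have := h _ hl (order_gt0 w) hd.
by rewrite expg_order eqxx.
Qed.

Lemma coxm_val : coxm i j = nth 0%N [:: 2; 3; 4; 6] k.
Proof.
have q0 : (0 < k)%N -> q != 0.
  move=> h; apply/eqP=> e; move: pq; rewrite e mulr0 => /esym/eqP.
  by rewrite pnatr_eq0 -leqn0 leqNgt h.
have pq0 : k%:R = 0 :> R -> p = 0 /\ q = 0.
  move=> k0; have /eqP : 4%:R * dotp a b ^+ 2 = 0 by rewrite hk k0 mul0r.
  rewrite mulf_eq0 pnatr_eq0 /= sqrf_eq0 => /eqP ab0.
  by rewrite /p /g /q /f [dotp b a]dotpC ab0 mulr0 !mul0r.
move: (w1) (wn1) pq q0 pq0; rewrite /step; generalize p, q => p' q' w1' wn1'.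
case: k k4 => [|[|[|[|//]]]] _ hpq q0 pq0 /=.
- have [//|ep eq] := pq0.
  apply: ord => //.
    by apply: w1' => fv gv /=; rewrite eq ep; congr pair; ring.
  move=> [|[|//]] // _ _ _; apply: wn1' => /=; rewrite ?eq ep.
  by rewrite ?(mul0r, mulr0, addr0, add0r, sub0r) oppr_eq0 pnatr_eq0.
- have ep : p' = q'^-1 by apply: (mulIf (q0 isT)); rewrite hpq mulVf ?q0.
  apply: ord => //.
    by apply: w1' => fv gv /=; rewrite ep; congr pair; field; rewrite q0.
  move=> [|[|[|//]]] // _ _ // _; apply: wn1' => /=; rewrite ep.
  by rewrite ?(mul0r, mulr0, addr0, add0r, sub0r) oppr_eq0 pnatr_eq0.
- have ep : p' = 2%:R / q' by apply: (mulIf (q0 isT)); rewrite hpq mulfVK ?q0.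
  apply: ord => //.
    by apply: w1' => fv gv /=; rewrite ep; congr pair; field; rewrite q0.
  move=> [|[|[|[|//]]]] // _ _ // _; apply: wn1' => /=; rewrite ep.
    by rewrite ?(mul0r, mulr0, addr0, add0r, sub0r) oppr_eq0 pnatr_eq0.
  rewrite [X in X != 0](_ : _ = - 2%:R); last by field; rewrite q0.
  by rewrite oppr_eq0 pnatr_eq0.
- have ep : p' = 3%:R / q' by apply: (mulIf (q0 isT)); rewrite hpq mulfVK ?q0.
  apply: ord => //.
    by apply: w1' => fv gv /=; rewrite ep; congr pair; field; rewrite q0.
  move=> [|[|[|[|[|[|//]]]]]] // _ _ // _; apply: wn1' => /=; rewrite ep.
  + by rewrite ?(mul0r, mulr0, addr0, add0r, sub0r) oppr_eq0 pnatr_eq0.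
  + rewrite [X in X != 0](_ : _ = - 3%:R); last by field; rewrite q0.
    by rewrite oppr_eq0 pnatr_eq0.
  + rewrite [X in X != 0](_ : _ = - 2%:R); last by field; rewrite q0.
    by rewrite oppr_eq0 pnatr_eq0.
Qed.
End CoxeterOrder.
End WeylFacts.

Section SpinWeyl.
Variables (R : realType) (W : weyl_group R).
Local Notation C := R[i].
Local Notation n := (rank W).
Local Notation toC := (real_complex R).

Fact two_neq0C : 2%:R != 0 :> C.
Proof. by rewrite pnatr_eq0. Qed.

(* The reflection representation V is 'cV[C]_n. *)
Definition clV : superalg C := clifford n two_neq0C.

Local Notation iota := (@cliff_iota C n two_neq0C).

Definition wrepC (w : wgroup W) : 'M[C]_n := map_mx toC (wrep W w).

Fact wrepC_orth w : (wrepC w)^T *m wrepC w = 1%:M.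
Proof. by rewrite /wrepC matrix.map_trmx -map_mxM wrep_orth map_mx1. Qed.

Definition clV_map (w : wgroup W) : superhom clV clV :=
  cliff_map two_neq0C (wrepC_orth w).

Lemma clV_mapE w v : clV_map w (iota v) = iota (wrepC w *m v).
Proof. exact: cliff_mapE. Qed.

Fact clV_map1 x : clV_map 1%g x = x.
Proof.
apply: (cliff_ext (f := clV_map 1%g) (h := sh_id clV)) => v.
by rewrite clV_mapE /wrepC wrep1 map_mx1 mul1mx.
Qed.
Fact clV_mapM u v x : clV_map (u * v)%g x = clV_map u (clV_map v x).
Proof.
apply: (cliff_ext (f := clV_map (u * v)%g) (h := sh_comp (clV_map u) (clV_map v))).
move=> y; rewrite -[RHS]/(clV_map u (clV_map v (iota y))) !clV_mapE.
by rewrite /wrepC wrepM map_mxM mulmxA.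
Qed.

Definition clV_aut : autact clV (wgroup W) := AutAct clV_map1 clV_mapM.

Definition hecke_clifford : superalg C := sdsalg clV_aut.
Definition clV_module : smodule hecke_clifford := sdmodule clV_aut.

Definition unit_root (i : 'I_n) : 'cV[C]_n :=
  map_mx toC ((Num.sqrt (dotp (tnth (sroot W) i) (tnth (sroot W) i)))^-1
              *: tnth (sroot W) i).

Definition beta (i : 'I_n) : clV := iota (unit_root i).

Inductive spin_rel : term C 'I_n -> term C 'I_n -> Prop :=
| spin_rel_braid i j :
    spin_rel (TExp (TMul (TVar i) (TVar j)) (coxm i j))
             (TConst ((-1) ^+ (coxm i j).+1)).

Lemma beta_part i : sa_part true (beta i).
Proof. exact: (palg_part_gen (P := cliff_pres C n)). Qed.

Let cdot i j : R := dotp (tnth (sroot W) i) (tnth (sroot W) j).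

Let nrm i : R := (Num.sqrt (cdot i i))^-1.

Let nrm2 i : nrm i ^+ 2 = (cdot i i)^-1.
Proof. by rewrite exprVn sqr_sqrtr // ltW ?al_gt0. Qed.

Let dotp_unit i j :
  dotp (unit_root i) (unit_root j) = toC (nrm i * nrm j * cdot i j).
Proof.
rewrite /dotp /unit_root matrix.map_trmx -map_mxM mxE; congr (toC _).
by rewrite -[LHS]/(dotp _ _) dotpZr dotpZl mulrCA mulrA.
Qed.

Let toC2 (y : R) : toC (2%:R * y) = 2%:R * toC y.
Proof. by rewrite [LHS]rmorphM /=; congr (_ * _); exact: rmorph_nat. Qed.

Lemma betaM i j :
  beta i * beta j + beta j * beta i = (toC (2%:R * (nrm i * nrm j * cdot i j)))%:A.
Proof.
rewrite /beta /cliff_iota [LHS]cliff_genE dotp_unit; congr (_ *: _).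
exact/esym/toC2.
Qed.

Lemma beta2 i : beta i * beta i = 1.
Proof.
have := betaM i i; rewrite -[nrm i * nrm i]expr2 nrm2 mulVf; last by rewrite gt_eqF ?al_gt0.
rewrite toC2 rmorph1 mulr1 -mulr2n -scaler_nat.
move/(congr1 (fun x => 2%:R^-1 *: x)).
by rewrite !scalerA mulVf ?two_neq0C // !scale1r.
Qed.

Lemma beta_braid i j : (beta i * beta j) ^+ coxm i j = ((-1) ^+ (coxm i j).+1)%:A.
Proof.
have [<-|hij] := eqVneq i j.
  by rewrite coxmii beta2 expr1 expr2 mulN1r opprK scale1r.
have [k k4 hk] := cartan_nat hij.
rewrite (coxm_val hij k4 hk).
pose d := 2%:R * (nrm i * nrm j * cdot i j).
have gi : 0 < cdot i i := al_gt0 i; have gj : 0 < cdot j j := al_gt0 j.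
have d0 : d <= 0.
  rewrite /d pmulr_rle0 ?ltr0n // pmulr_rle0 ?dotp_le0 //.
  by rewrite mulr_gt0 // invr_gt0 sqrtr_gt0.
have d2 : d ^+ 2 = k%:R.
  have -> : d ^+ 2 = 4%:R * cdot i j ^+ 2 * ((cdot i i)^-1 * (cdot j j)^-1).
    by rewrite -!nrm2 /d; ring.
  have -> : 4%:R * cdot i j ^+ 2 = k%:R * (cdot i i * cdot j j) := hk.
  by field; rewrite !gt_eqF.
set x := beta i * beta j.
have e : beta j * beta i = (toC d)%:A - x by rewrite -betaM addrAC subrr add0r.
have x2 : x * x = toC d *: x - 1.
  rewrite {1 2}/x -mulrA [beta j * _]mulrA e mulrBl mulrBr mulr_algl.
  by rewrite -scalerAr -/x {1}/x -mulrA beta2 mulr1 beta2.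
have D2 : toC d ^+ 2 = k%:R by rewrite -rmorphXn d2; exact: rmorph_nat.
have xl p q : x * (p *: x + q%:A) = (p * toC d + q) *: x + (- p)%:A.
  rewrite mulrDr -!scalerAr x2 mulr1 scalerBr scalerA scalerDl scaleNr.
  by rewrite addrAC.
have x1 : x = 1 *: x + 0%:A by rewrite scale1r scale0r addr0.
have fin m p q : x ^+ m.+1 = p *: x + q%:A -> p = 0 -> q = (-1) ^+ m.+2 ->
    x ^+ m.+1 = ((-1) ^+ m.+2)%:A.
  by move=> -> -> ->; rewrite scale0r add0r.
have xS m p q : x ^+ m.+1 = p *: x + q%:A ->
    x ^+ m.+2 = (p * toC d + q) *: x + (- p)%:A by move=> h; rewrite exprS h.
have h1 : x ^+ 1 = 1 *: x + 0%:A by rewrite expr1.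
have h2 := xS _ _ _ h1; have h3 := xS _ _ _ h2; have h4 := xS _ _ _ h3.
have h6 := xS _ _ _ (xS _ _ _ h4).
have Dk (a b c : C) : a = b + c * (toC d ^+ 2 - k%:R) -> a = b.
  by move=> ->; rewrite D2 subrr mulr0 addr0.
clear xS x1 xl x2 e; case: k k4 hk d2 D2 Dk => [|[|[|[|//]]]] _ _ d2 D2 Dk.
- have z : toC d = 0 by apply/eqP; rewrite -sqrf_eq0 D2.
  by apply: fin h2 _ _; rewrite ?z; ring.
- have z : toC d = - 1.
    have /eqP : d ^+ 2 = 1 by [].
    rewrite sqrf_eq1 => /orP [/eqP d1|/eqP ->]; last by rewrite rmorphN1.
    by move: d0; rewrite d1 ler10.
  by apply: fin h3 _ _; rewrite ?z; ring.
- apply: fin h4 _ _.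
    by apply: (Dk _ _ (toC d)); ring.
  by apply: (Dk _ _ (-1)); ring.
- apply: fin h6 _ _.
    by apply: (Dk _ _ (toC d ^+ 3 - toC d)); ring.
  by apply: (Dk _ _ (- toC d ^+ 2)); ring.
Qed.

Lemma spin_nontrivial : ~ cong spin_rel (TConst 1) (TConst 0).
Proof.
pose g i (x : clV) := beta i * x.
have gL i : linear (g i) by move=> a u v; rewrite /g mulrDr scalerAr.
have gX i j m x : tact g (TExp (TMul (TVar i) (TVar j)) m) x
    = (beta i * beta j) ^+ m * x.
  elim: m => [|m IH] /=; first by rewrite scale1r mul1r.
  by rewrite IH /g exprS !mulrA.
have gR t u : spin_rel t u -> tact g t =1 tact g u.
  by case=> i j x; rewrite gX beta_braid mulr_algl.
move=> /(tact_cong gL gR) /(_ 1) /= /eqP.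
by rewrite scale1r scale0r; exact/negP/oner_neq0.
Qed.

Definition spin_pres : presentation C := Presentation spin_nontrivial.

Lemma spin_tneg t u : spin_rel t u -> cong spin_rel (tneg t) (tneg u).
Proof.
move=> h; apply/(@pclsP C spin_pres); case: h => {t u} i j.
have tX X (t : term C X) k : tneg (TExp t k) = TExp (tneg t) k.
  by elim: k => [|k IH] //=; rewrite IH.
rewrite tX pclsX /= !pclsM !pclsC !mulr_algl -scalerAl -scalerAr scalerA.
rewrite mulrNN mulr1 scale1r -pclsM -pclsX -pclsC; apply/pclsP.
exact: (cong_rel (spin_rel_braid i j)).
Qed.

(* The algebra on t_i with (t_i t_j)^m_ij = (-1)^(m_ij + 1), each t_i odd. *)
Definition spin_alg : superalg C := @psalg C two_neq0C spin_pres spin_tneg.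

Definition spin_gen (i : 'I_n) : spin_alg := pgen spin_pres i.

Fact Omega_respects : @respects C spin_pres clV beta.
Proof.
move=> _ _ [i j]; rewrite (tevalX (P := spin_pres)) /=.
exact: beta_braid.
Qed.

Definition Omega : superhom spin_alg clV :=
  @pshom C two_neq0C spin_pres spin_tneg clV beta Omega_respects beta_part.

Definition beta_s (i : 'I_n) : hecke_clifford := sdelt clV_aut (beta i) (srefl i).

Lemma wrep_srefl_mx i : let a := tnth (sroot W) i in
  wrep W (srefl i) = 1%:M - (2%:R / dotp a a) *: (a *m a^T).
Proof.
move=> a; apply/matrixP=> k l.
rewrite -!dotp_delta wrep_refl; congr (dotp _ _).
rewrite mulmxBl mul1mx -scalemxAl -mulmxA [a^T *m _]mx11_scalar mul_mx_scalar.
by rewrite -/(dotp _ _) scalerA /reflection mulrAC.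
Qed.

Lemma clV_map_srefl i v : clV_map (srefl i) (iota v) = - (beta i * iota v * beta i).
Proof.
rewrite clV_mapE /wrepC wrep_srefl_mx.
set a := tnth _ _.
have -> : map_mx toC (1%:M - (2%:R / dotp a a) *: (a *m a^T)) *m v
   = v - (2%:R * dotp (unit_root i) v) *: unit_root i.
  have -> : (2%:R / dotp a a) *: (a *m a^T)
     = 2%:R *: ((nrm i *: a) *m (nrm i *: a)^T).
    rewrite linearZ /= -scalemxAl -scalemxAr !scalerA.
    by rewrite -mulrA -expr2 nrm2.
  rewrite map_mxB map_mx1 map_mxZ map_mxM -matrix.map_trmx -/(unit_root i).
  rewrite mulmxBl mul1mx -scalemxAl -mulmxA [_^T *m v]mx11_scalar mul_mx_scalar.
  rewrite -/(dotp _ _) scalerA; congr (_ - (_ * _) *: _).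
  exact: rmorph_nat.
have -> : iota (v - (2%:R * dotp (unit_root i) v) *: unit_root i)
    = iota v - (2%:R * dotp (unit_root i) v) *: beta i.
  rewrite addrC -scaleNr /cliff_iota cliff_gen_linear scaleNr addrC //.
have e : beta i * iota v + iota v * beta i = (2%:R * dotp (unit_root i) v)%:A.
  exact: cliff_genE.
rewrite -mulr_algl -e mulrDl -[iota v * beta i * beta i]mulrA beta2 mulr1.
by rewrite opprD addrCA subrr addr0.
Qed.

Lemma clV_map_beta i j : clV_map (srefl i) (beta j) = - (beta i * beta j * beta i).
Proof. exact: clV_map_srefl. Qed.

Lemma coxmC (i j : 'I_n) : coxm i j = coxm j i.
Proof.
rewrite /coxm -[RHS]orderV invMg; congr #[_ * _]%g.
  by apply/esym/eqP; rewrite eq_invg_mul srefl2.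
by apply/esym/eqP; rewrite eq_invg_mul srefl2.
Qed.

Fact Psi_respects : @respects C spin_pres hecke_clifford (fun i => 'i%C *: beta_s i).
Proof.
move=> _ _ [i j]; rewrite (tevalX (P := spin_pres)) /=.
set w := (srefl i * srefl j)%g; set y := beta j * beta i.
have mM u v : clV_map w (u * v) = clV_map w u * clV_map w v.
  exact: (sh_monoid (clV_map w)).2.
have bb k (z : clV) : beta k * (beta k * z) = z by rewrite mulrA beta2 mul1r.
have ab k l : clV_aut (srefl k) (beta l) = - (beta k * beta l * beta k).
  exact: clV_map_beta.
have wy : clV_map w y = y.
  rewrite clV_mapM /y (sh_monoid (clV_map (srefl j))).2 !clV_map_beta.
  rewrite beta2 mul1r mulrNN -!mulrA bb (sh_monoid (clV_map (srefl i))).2.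
  by rewrite !clV_map_beta beta2 mul1r mulrNN -!mulrA bb.
have -> : 'i%C *: beta_s i * ('i%C *: beta_s j) = sdelt clV_aut y w.
  rewrite -scalerAl -scalerAr scalerA sdeltM ab mulrN -!mulrA bb.
  have -> : 'i%C * 'i%C = -1 :> C by rewrite -expr2 sqr_i.
  by rewrite scaleN1r -/y -/w (linN _ (@sdelt_linear _ _ _ clV_aut w)) opprK.
have pw m : sdelt clV_aut y w ^+ m = sdelt clV_aut (y ^+ m) (w ^+ m)%g.
  elim: m => [|m IH]; first by rewrite expr0 expg0.
  rewrite exprS IH sdeltM expgS exprS; congr (sdelt _ (_ * _) _).
  rewrite -[LHS]/(clV_map w (y ^+ m)); elim: m {IH} => [|m IH].
    exact: (sh_monoid (clV_map w)).1.
  by rewrite exprS mM wy IH.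
rewrite pw expg_order coxmC /y beta_braid.
exact: (linZ _ _ (@sdelt_linear _ _ _ clV_aut 1%g)).
Qed.

Fact Psi_part i : sa_part true ('i%C *: beta_s i : hecke_clifford).
Proof.
apply: (@subZ C hecke_clifford (sa_part true)).
  exact: graded_sub (sa_graded hecke_clifford) true.
exact: sdpart_elt (beta_part i).
Qed.

(* The restriction to CW^- of the inverse of the isomorphism of the           *)
(* Hecke-Clifford superalgebra with the tensor product of Cl_V and CW^-.      *)
Definition Psi : superhom spin_alg hecke_clifford :=
  @pshom C two_neq0C spin_pres spin_tneg hecke_clifford _ Psi_respects Psi_part.

Lemma Psi_gen i : Psi (spin_gen i) = 'i%C *: beta_s i.
Proof. by rewrite /= plift_gen //; apply: Psi_respects. Qed.

Fact Psi_comm b c (y : spin_alg) (x : clV) : sa_part b y -> sa_part c x ->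
  Psi y * sd_emb clV_aut x = (-1) ^+ (b && c) *: (sd_emb clV_aut x * Psi y).
Proof.
move=> hy hx.
have hg i : Psi (spin_gen i) * sd_emb clV_aut x
    = (-1) ^+ c *: (sd_emb clV_aut x * Psi (spin_gen i)).
  apply: (@psuper_comm C two_neq0C (cliff_pres C n) (@cliff_tneg C n) hecke_clifford
    (sd_emb clV_aut) _ true _ c x hx) => v.
  rewrite Psi_gen -scalerAl -scalerAr !sdeltM mulg1 mul1g scaleN1r -scalerN.
  rewrite -(linN _ (@sdelt_linear _ _ _ clV_aut _)); congr (_ *: sdelt _ _ _).
  rewrite -[clV_aut _ _]/(clV_map (srefl i) (iota v)) clV_map_srefl.
  rewrite -[clV_aut _ _]/(clV_map 1%g (beta i)) clV_map1.
  rewrite mulrN; congr (- _).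
  by rewrite [LHS]mulrA [beta i * (_ * _)]mulrA beta2 mul1r.
have := @psuper_comm C two_neq0C spin_pres spin_tneg hecke_clifford Psi
  (sd_emb clV_aut x) c _ b y hy.
rewrite andbC => -> => [|i].
  by rewrite scalerA -signr_addb addbb scale1r.
by rewrite hg scalerA -signr_addb addbb scale1r.
Qed.

(* For U the simple Cl_V-module, this is B_W. *)
Definition basic_spin (U : smodule clV) : smodule spin_alg := pullback Omega U.

(* Hom_{Cl_V}(U, N) with (t_i f)(u) = sqrt(-1) beta_i s_i f(u). *)
Definition functorG (U : smodule clV) (N : smodule hecke_clifford) :
  smodule spin_alg := hommod Psi_comm U N.

Lemma functorG_gen U N i (f : functorG U N) u :
  hom_fun (sm_act (spin_gen i) f) u = 'i%C *: sm_act (beta_s i) (hom_fun f u : N).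
Proof.
rewrite -[LHS]/(sm_act (Psi (spin_gen i)) (hom_fun f u)) Psi_gen.
exact: (linZ _ _ (sm_actl (hom_fun f u : N))).
Qed.

End SpinWeyl.

(* Main.v *)
Require Import Defs.
From mathcomp Require Import all_boot all_order all_algebra reals complex.
From HB Require Import structures.
From mathcomp Require Import boolp functions ring spectral.

(**
The whole theorem comes from two properties of the Clifford superalgebra A = Cl_V
and one formula for the reflections.

Let e_i be an orthonormal basis of V. The operator x |-> (x + e_i par(x) e_i) / 2,
with par the parity automorphism, deletes the monomials that contain e_i. It
preserves every graded two-sided ideal and fixes every supercentral element.
Applying it for all i leaves the scalar part. Hence A is simple as a superalgebra
([cliff_simple]), its supercentre consists of the scalars ([supercentral_scalar]),
and the scalar part is a nondegenerate trace form ([scalar_part_nondegenerate]).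

The simple reflection s_i acts on A by x |-> beta_i par(x) beta_i
([clV_map_srefl_par]). A graded submodule of A over the Hecke-Clifford algebra is
therefore a left ideal stable under right multiplication by the beta_i, which span
V: a two-sided ideal. An endomorphism of this module is right supermultiplication by
a W-invariant z, and invariance means that z is supercentral. This gives the
simplicity of A and its type M.

The map Omega is onto because the simple roots span V, so B_W and U have the same
graded submodules and the same homogeneous endomorphisms. By Schur's lemma the even
endomorphisms of U are the scalars. The product of all e_i acts, up to signs, as an
invertible endomorphism of the parity of dim V ([volume_hom]). If dim V is odd, this
is an odd endomorphism, and every other one is a multiple of it. If dim V is even,
it is a nonzero scalar with which an odd endomorphism must anticommute, so there is
none ([cliff_odd_hom_eq0]).

On Hom(U, A) the generator t_i acts by sqrt(-1) par(f u) beta_i, again by the formula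
for s_i. Fix homogeneous u1 and u0 in U. Apply to f u1 the anti-automorphism that
fixes V, multiply the odd part by a suitable fourth root of unity, and let the result
act on u0: this is a homogeneous homomorphism Hom(U, A) -> B_W ([eval_map_hom]). It is
nonzero for some u1 and u0, since averaging a functional on U over the monomials in
the e_i yields a nonzero element of Hom(U, A) ([regular_hom]) and A acts faithfully on
U. It is onto because B_W is simple, and injective because taking scalar parts embeds
Hom(U, A) into the dual of U ([scalar_part_separates_homs]).
*)

Set Implicit Arguments.
Unset Strict Implicit.
Unset Printing Implicit Defensive.

Import Order.TTheory GRing.Theory Num.Theory.
Local Open Scope ring_scope.

(** * The parity involution of a graded space *)

Section Parity.
Variables (F : fieldType) (V : lmodType F) (p : bool -> V -> Prop).
Hypothesis gp : graded p.

(** The map v0 + v1 |-> v0 - v1. Writing all signs (-1)^|x| through this linear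
    involution lets the proofs below avoid case distinctions on homogeneous
    components. *)
Fact par_exists : exists f : V -> V, forall v0 v1,
  p false v0 -> p true v1 -> f (v0 + v1) = v0 - v1.
Proof.
have /choice [f hf] : forall v, exists u, forall v0 v1,
    p false v0 -> p true v1 -> v = v0 + v1 -> u = v0 - v1.
  move=> v; have [u0 [u1 [k0 k1 ->]]] := graded_sum gp v; exists (u0 - u1).
  by move=> v0 v1 h0 h1 e; have [-> ->] := graded_uniq gp k0 k1 h0 h1 e.
by exists f => v0 v1 h0 h1; apply: hf.
Qed.

Definition par : V -> V := projT1 (cid par_exists).

Lemma par_sum v0 v1 : p false v0 -> p true v1 -> par (v0 + v1) = v0 - v1.
Proof. exact: projT2 (cid par_exists) v0 v1. Qed.

Lemma par_homog b v : p b v -> par v = (-1) ^+ b *: v.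
Proof.
have z c := sub0 (graded_sub gp c).
case: b => h; first by rewrite -[in LHS](add0r v) par_sum // sub0r scaleN1r.
by rewrite -[in LHS](addr0 v) par_sum // subr0 scale1r.
Qed.

Lemma par_linear : linear par.
Proof.
have s c := graded_sub gp c.
move=> a u v; have [u0 [u1 [hu0 hu1 ->]]] := graded_sum gp u.
have [v0 [v1 [hv0 hv1 ->]]] := graded_sum gp v.
rewrite scalerDr addrACA !par_sum //; try exact: (s _).2.
by rewrite scalerBr opprD addrACA.
Qed.

Lemma parK : involutive par.
Proof.
move=> v; have [v0 [v1 [h0 h1 ->]]] := graded_sum gp v.
by rewrite par_sum // par_sum ?opprK //; apply: subN (graded_sub gp _) _.
Qed.

(** In characteristic other than 2 the two parts are the eigenspaces of the
    involution, so a map commuting with it preserves parity. *)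
Lemma homogP b v : 2%:R != 0 :> F -> p b v <-> par v = (-1) ^+ b *: v.
Proof.
move=> two_neq0; split=> [|h]; first exact: par_homog.
have [v0 [v1 [h0 h1 e]]] := graded_sum gp v.
have dbl (u : V) : u = - u -> u = 0.
  move=> /eqP; rewrite -addr_eq0 -mulr2n -scaler_nat scaler_eq0.
  by rewrite (negPf two_neq0) => /eqP.
move: h; rewrite e par_sum //; case: b => /eqP.
  rewrite scaleN1r opprD (can_eq (addrK _)) => /eqP /dbl ->.
  by rewrite add0r.
rewrite scale1r (inj_eq (addrI _)) eq_sym => /eqP /dbl ->.
by rewrite addr0.
Qed.

End Parity.

Notation par_alg A := (par (sa_graded A)).
Notation par_mod M := (par (sm_graded M)).

Section ParityMaps.
Variables (F : fieldType).

Lemma par_morph (V V' : lmodType F) (p : bool -> V -> Prop) (q : bool -> V' -> Prop)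
    (gp : graded p) (gq : graded q) (e : bool) (f : V -> V') : linear f ->
  (forall b v, p b v -> q (b (+) e) (f v)) ->
  forall v, par gq (f v) = (-1) ^+ e *: f (par gp v).
Proof.
move=> fl fp v; have [v0 [v1 [h0 h1 ->]]] := graded_sum gp v.
rewrite (linD _ _ fl) (linD _ _ (par_linear gq)) (linD _ _ (par_linear gp)).
rewrite (par_homog gp h0) (par_homog gp h1) (par_homog gq (fp _ _ h0)).
rewrite (par_homog gq (fp _ _ h1)) (linD _ _ fl) !(linZ _ _ fl) scalerDr !scalerA.
by rewrite -!signr_addb addbC [true (+) e]addbC.
Qed.

Variable A : superalg F.

Lemma par_act (M : smodule A) (a : A) (m : M) :
  par_mod M (sm_act a m) = sm_act (par_alg A a) (par_mod M m).
Proof.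
have [a0 [a1 [h0 h1 ->]]] := graded_sum (sa_graded A) a.
have h b x : sa_part b x ->
    par_mod M (sm_act x m) = sm_act (par_alg A x) (par_mod M m).
  move=> hx; rewrite (par_homog _ hx) (linZ _ _ (sm_actl _)).
  apply: (@par_morph _ _ _ _ (sm_graded M) (sm_graded M) b); first exact: sm_actr.
  by move=> c v hv; rewrite addbC; apply: sm_act_part.
rewrite (linD _ _ (sm_actl _)) !(linD _ _ (par_linear _)) (linD _ _ (sm_actl _)).
by rewrite (h _ _ h0) (h _ _ h1).
Qed.

Lemma par1 : par_alg A 1 = 1.
Proof. by rewrite (par_homog _ (sa_part1 A)) scale1r. Qed.

Lemma parM (x y : A) : par_alg A (x * y) = par_alg A x * par_alg A y.
Proof.
have [x0 [x1 [h0 h1 ->]]] := graded_sum (sa_graded A) x.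
have h b z : sa_part b z -> par_alg A (z * y) = par_alg A z * par_alg A y.
  move=> hz; rewrite (par_homog _ hz) -scalerAl.
  apply: (@par_morph _ _ _ _ (sa_graded A) (sa_graded A) b (fun w => z * w)).
    by move=> a u v; rewrite mulrDr scalerAr.
  by move=> c v hv; rewrite addbC; apply: sa_partM.
by rewrite mulrDl !(linD _ _ (par_linear _)) mulrDl (h _ _ h0) (h _ _ h1).
Qed.

Lemma sh_par (B : superalg F) (h : superhom A B) (x : A) :
  par_alg B (h x) = h (par_alg A x).
Proof.
rewrite (par_morph (sa_graded A) (sa_graded B) (e := false) (sh_linear h)) ?scale1r //.
by move=> b v hv; rewrite addbF; apply: sh_part.
Qed.

End ParityMaps.

(** * Homogeneous homomorphisms and Schur's lemma *)

Section Modules.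
Variables (F : fieldType) (two_neq0 : 2%:R != 0 :> F) (A : superalg F).
Implicit Types M N K : smodule A.

(** The components of m are (m + par m) / 2 and (m - par m) / 2. *)
Lemma graded_submodule_par M (p : M -> Prop) :
  subspace p -> (forall a m, p m -> p (sm_act a m)) ->
  (forall m, p m -> p (par_mod M m)) -> graded_submodule p.
Proof.
move=> ps pa pp; split=> // m pm.
have [m0 [m1 [h0 h1 e]]] := graded_sum (sm_graded M) m.
have half (x : M) : x = 2%:R^-1 *: (x + x).
  by rewrite -mulr2n -scaler_nat scalerA mulVf // scale1r.
have pq := pp _ pm; rewrite e par_sum // in pq; rewrite e in pm.
exists m0, m1; split=> //; split=> //.
  rewrite (half m0); apply: subZ => //.
  have -> : m0 + m0 = (m0 + m1) + (m0 - m1) by rewrite addrACA subrr addr0.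
  exact: subD.
rewrite (half m1); apply: subZ => //.
have -> : m1 + m1 = (m0 + m1) - (m0 - m1) by rewrite opprB [RHS]addrC addrA subrK.
by apply: subD => //; apply: subN.
Qed.

Lemma submodule_par M (p : M -> Prop) m : graded_submodule p -> p m -> p (par_mod M m).
Proof.
move=> hp pm; have [m0 [m1 [[p0 h0] [p1 h1] ->]]] := gs_graded hp pm.
rewrite par_sum //; apply: subD (gs_subspace hp) p0 _.
exact: subN (gs_subspace hp) p1.
Qed.

(** The sign rule for all a at once: an odd homomorphism is semilinear with
    respect to the parity automorphism of A. *)
Lemma hom_act M N e (f : M -> N) a m : homog_hom e f ->
  f (sm_act a m) = sm_act (iter e (par_alg A) a) (f m).
Proof.
move=> hf; have [a0 [a1 [h0 h1 ->]]] := graded_sum (sa_graded A) a.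
have h b x : sa_part b x -> f (sm_act x m) = sm_act (iter e (par_alg A) x) (f m).
  move=> hx; rewrite (hh_act hf _ hx); case: e {hf} => /=; last by rewrite scale1r.
  by rewrite (par_homog _ hx) (linZ _ _ (sm_actl _)).
have -> : iter e (par_alg A) (a0 + a1) = iter e (par_alg A) a0 + iter e (par_alg A) a1.
  by case: e {hf h} => //=; rewrite (linD _ _ (par_linear _)).
rewrite !(linD _ _ (sm_actl _)) (linD _ _ (hh_linear hf)).
by rewrite (h _ _ h0) (h _ _ h1).
Qed.

Lemma hom_par M N e (f : M -> N) m : homog_hom e f ->
  f (par_mod M m) = (-1) ^+ e *: par_mod N (f m).
Proof.
move=> hf; rewrite (par_morph (sm_graded M) (sm_graded N) (hh_linear hf) (hh_part hf)).
by rewrite scalerA -signr_addb addbb scale1r.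
Qed.

Lemma hom_ker M N e (f : M -> N) : homog_hom e f ->
  graded_submodule (fun m => f m = 0).
Proof.
move=> hf; have fl := hh_linear hf; apply: graded_submodule_par.
- split=> [|a u v hu hv]; first exact: lin0.
  by rewrite (linD _ _ fl) (linZ _ _ fl) hu hv scaler0 addr0.
- by move=> a m h; rewrite (hom_act _ _ hf) h (lin0 (sm_actr _)).
- by move=> m h; rewrite (hom_par _ hf) h (lin0 (par_linear _)) scaler0.
Qed.

Lemma hom_image M N e (f : M -> N) : homog_hom e f ->
  graded_submodule (fun x => exists m, x = f m).
Proof.
move=> hf; have fl := hh_linear hf; apply: graded_submodule_par.
- split=> [|a _ _ [u ->] [v ->]]; first by exists 0; rewrite lin0.
  by exists (a *: u + v); rewrite fl.
- move=> a _ [m ->]; exists (sm_act (iter e (par_alg A) a) m).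
  by rewrite (hom_act _ _ hf); case: e {hf} => //=; rewrite parK.
- move=> _ [m ->]; exists ((-1) ^+ e *: par_mod M m).
  by rewrite (linZ _ _ fl) (hom_par _ hf) scalerA -signr_addb addbb scale1r.
Qed.

Lemma schur_inj M N e (f : M -> N) : simple_module M -> homog_hom e f ->
  (exists m, f m <> 0) -> injective f.
Proof.
move=> [_ sM] hf [m fm]; have fl := hh_linear hf.
have [k0|k] := sM _ (hom_ker hf); last by case: fm; apply: k.
move=> u v e0; apply/eqP; rewrite -subr_eq0; apply/eqP/k0.
by rewrite (linD _ _ fl) (linN _ fl) e0 subrr.
Qed.

Lemma schur_surj M N e (f : M -> N) : simple_module N -> homog_hom e f ->
  (exists m, f m <> 0) -> forall x, exists m, x = f m.
Proof.
move=> [_ sN] hf [m fm]; have [i0|//] := sN _ (hom_image hf).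
by case: fm; apply: i0; exists m.
Qed.

Lemma homog_hom_comp M N K e e' (f : M -> N) (g : N -> K) :
  homog_hom e f -> homog_hom e' g -> homog_hom (e (+) e') (g \o f).
Proof.
move=> [fl fp fa] [gl gp ga]; split=> [a u v|b m hm|b a m ha] /=.
- by rewrite fl gl.
- by rewrite addbA; apply/gp/fp.
- rewrite (fa b) // (linZ _ _ gl) (ga b) // scalerA -signr_addb.
  by rewrite andb_addl.
Qed.

Lemma hom_space_ext M N (f g : hom_space M N) :
  hom_fun f =1 hom_fun g -> f = g.
Proof. by move=> h; apply: val_inj; apply/funext. Qed.

Lemma is_hom_homog M N e (f : M -> N) : homog_hom e f -> is_hom f.
Proof.
move=> hf; have s b := homog_hom_subspace M N b.
case: e hf => hf.
  by exists 0, f; split=> // [|m]; [exact: sub0 | rewrite /= add0r].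
by exists f, 0; split=> // [|m]; [exact: sub0 | rewrite /= addr0].
Qed.

Definition homog_elt M N e (f : M -> N) (hf : homog_hom e f) : hom_space M N :=
  HomSpace (introT (hom_predP f) (is_hom_homog hf)).

Lemma homog_hom_id M : homog_hom false (@id M).
Proof. by split=> // [b m|b a m _]; [rewrite addbF | rewrite scale1r]. Qed.

(** To know the span of the homogeneous endomorphisms it is enough to know the
    homogeneous ones; this form transfers along pullbacks, where the type
    hom_space changes but the underlying maps do not. *)
Lemma typeM_of M : (exists m : M, m <> 0) ->
  (forall f : M -> M, homog_hom false f -> exists c, forall m, f m = c *: m) ->
  (forall f : M -> M, homog_hom true f -> forall m, f m = 0) -> typeM M.
Proof.
move=> [m0 /eqP nz] h0 h1.
have sc (f : hom_space M M) : exists c, forall m, hom_fun f m = c *: m.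
  have [f0 [f1 [/h0 [c hc] /h1 z e]]] := hom_spaceP f.
  by exists c => m; rewrite e hc z addr0.
pose c f := projT1 (cid (sc f)).
have cP f m : hom_fun f m = c f *: m by exact: projT2 (cid (sc f)) m.
have cinj x y : x *: m0 = y *: m0 -> x = y.
  move=> /eqP; rewrite -subr_eq0 -scalerBl scaler_eq0 (negPf nz) orbF subr_eq0.
  by move/eqP.
pose I : hom_space M M := homog_elt (homog_hom_id M).
exists (fun f => \row_(_ < 1) c f); split.
  move=> a f g; apply/rowP=> j; rewrite !mxE; apply: cinj.
  rewrite -cP [LHS]/(a *: hom_fun f m0 + hom_fun g m0).
  by rewrite !cP scalerDl scalerA.
exists (fun r : 'rV_1 => r 0 0 *: I) => [f|r].
  by apply: hom_space_ext => m; rewrite [RHS]cP mxE.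
by apply/rowP=> j; rewrite mxE (ord1 j); apply: cinj; rewrite -cP.
Qed.

(** The identity and J have different parities, hence are independent, and by
    hypothesis they span. *)
Lemma typeQ_of M (J : M -> M) :
  homog_hom true J -> (exists m, J m <> 0) ->
  (forall f : M -> M, homog_hom false f -> exists c, forall m, f m = c *: m) ->
  (forall f : M -> M, homog_hom true f -> exists c, forall m, f m = c *: J m) ->
  typeQ M.
Proof.
move=> hJ [m1 /eqP nz] h0 h1.
have sc (f : hom_space M M) : exists c : F * F,
    forall m, hom_fun f m = c.1 *: m + c.2 *: J m.
  have [f0 [f1 [/h0 [c hc] /h1 [d hd] e]]] := hom_spaceP f.
  by exists (c, d) => m; rewrite e hc hd.
pose c f := projT1 (cid (sc f)).
have cP f m : hom_fun f m = (c f).1 *: m + (c f).2 *: J m.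
  exact: projT2 (cid (sc f)) m.
have cinj x y x' y' : (forall m, x *: m + y *: J m = x' *: m + y' *: J m) ->
    x = x' /\ y = y'.
  move=> h.
  (* On a homogeneous vector the two terms have opposite parities. *)
  have hs b m : sm_part b m -> x *: m = x' *: m /\ y *: J m = y' *: J m.
    move=> hm; have sb d := graded_sub (sm_graded M) d.
    have hJm : sm_part (~~ b) (J m) by rewrite -addbT; apply: hh_part hJ _ _ hm.
    have := h m; case: b hm hJm => hm hJm e0.
      have [] := graded_uniq (sm_graded M) (u0 := y *: J m) (u1 := x *: m)
        (v0 := y' *: J m) (v1 := x' *: m); try exact: subZ.
        by rewrite addrC e0 addrC.
      by [].
    by apply: (graded_uniq (sm_graded M)) e0; apply: subZ.
  have ha m : x *: m = x' *: m /\ y *: J m = y' *: J m.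
    have [u [v [hu hv ->]]] := graded_sum (sm_graded M) m.
    rewrite (linD _ _ (hh_linear hJ)) !scalerDr.
    by have [-> ->] := hs _ _ hu; have [-> ->] := hs _ _ hv.
  have [/eqP e0 _] := ha (J m1); have [_ /eqP e1] := ha m1.
  split; apply/eqP; rewrite -subr_eq0.
    by move: e0; rewrite -subr_eq0 -scalerBl scaler_eq0 (negPf nz) orbF.
  by move: e1; rewrite -subr_eq0 -scalerBl scaler_eq0 (negPf nz) orbF.
pose I : hom_space M M := homog_elt (homog_hom_id M).
pose K : hom_space M M := homog_elt hJ.
exists (fun f => \row_(j < 2) if j == 0 then (c f).1 else (c f).2); split.
  move=> a f g; have [e1 e2] : (c (a *: f + g)).1 = a * (c f).1 + (c g).1
      /\ (c (a *: f + g)).2 = a * (c f).2 + (c g).2.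
    apply: cinj => m; rewrite -cP [LHS]/(a *: hom_fun f m + hom_fun g m) !cP.
    by rewrite scalerDr !scalerDl !scalerA addrACA.
  by apply/rowP=> j; rewrite !mxE; case: (j == 0).
exists (fun r : 'rV_2 => r 0 0 *: I + r 0 1 *: K) => [f|r].
  by apply: hom_space_ext => m; rewrite [RHS]cP !mxE.
have [e1 e2] : (c (r 0 0 *: I + r 0 1 *: K)).1 = r 0 0
    /\ (c (r 0 0 *: I + r 0 1 *: K)).2 = r 0 1.
  by apply: cinj => m; rewrite -cP.
apply/rowP=> j; rewrite !mxE e1 e2; case: eqP => [-> //|/eqP nj].
by congr (r _ _); apply/val_inj; case: j nj => [[|[|//]]].
Qed.

End Modules.

Section Schur.
Variables (F : numClosedFieldType) (A : superalg F) (M : smodule A).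
Hypotheses (Mfin : fin_dim M) (Msimple : simple_module M).

(** An eigenspace of an even endomorphism is a graded submodule, and over an
    algebraically closed field there is a nonzero one. *)
Lemma schur_scalar (f : M -> M) : homog_hom false f ->
  exists c, forall m, f m = c *: m.
Proof.
move=> hf; have fl := hh_linear hf.
have [k [b [bl [b' bK b'K]]]] := Mfin.
have b'l : linear b'.
  by move=> a u v; apply: (can_inj bK); rewrite bl !b'K.
have [[m0 nz] sM] := Msimple.
pose g : 'rV[F]_k -> 'rV[F]_k := b \o f \o b'.
have gl : linear g by move=> a u v; rewrite /g /= b'l fl bl.
pose gm : {linear 'rV[F]_k -> 'rV[F]_k} := HB.pack g (GRing.isLinear.Build _ _ _ _ g gl).
have gE v : v *m lin1_mx gm = g v by rewrite mul_rV_lin1.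
have k0 : (0 < k)%N.
  rewrite lt0n; apply/eqP=> e; apply: nz; apply: (can_inj bK).
  by subst k; rewrite [LHS]thinmx0 [RHS]thinmx0.
have [c /eigenvalueP [v ev nv]] := eigenvalue_closed (lin1_mx gm) k0.
exists c => m; apply/eqP; rewrite -subr_eq0; apply/eqP; move: m.
have sub : graded_submodule (fun m : M => f m - c *: m = 0).
  have hg : homog_hom false (fun m => f m - c *: m).
    have -> : (fun m => f m - c *: m) = (- c) *: (id : M -> M) + f.
      by apply/funext=> m; rewrite addrfctE scalrfctE scaleNr addrC.
    by apply: (homog_hom_subspace M M false).2 => //; apply: homog_hom_id.
  by apply: hom_ker hg; rewrite pnatr_eq0.
have [z|//] := sM _ sub; case/eqP: nv.
have hz : b' v = 0.
  apply: z; apply/eqP; rewrite subr_eq0; apply/eqP/(can_inj bK).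
  by rewrite -[LHS]/(g v) -gE ev (linZ _ _ bl) b'K.
by rewrite -(b'K v) hz (lin0 bl).
Qed.

(** J o J and J o f are even, hence scalars d and c, and d is nonzero because J
    is injective; cancelling J in J f = (c / d) J J gives the claim. *)
Lemma schur_odd (J f : M -> M) : homog_hom true J -> (exists m, J m <> 0) ->
  homog_hom true f -> exists c, forall m, f m = c *: J m.
Proof.
move=> hJ nJ hf; have two_neq0 : 2%:R != 0 :> F by rewrite pnatr_eq0.
have iJ := schur_inj two_neq0 Msimple hJ nJ.
have [d hd] := schur_scalar (homog_hom_comp hJ hJ).
have [c hc] := schur_scalar (homog_hom_comp hf hJ).
have Jl := hh_linear hJ.
have d0 : d != 0.
  have [m nm] := nJ; apply/eqP=> d0; apply: nm; apply: iJ.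
  by have := hd m; rewrite d0 scale0r /= (lin0 Jl).
exists (c / d) => m; apply: iJ.
by rewrite (linZ _ _ Jl) -[J (J m)]/((J \o J) m) hd scalerA divfK // -hc.
Qed.

End Schur.

(** * Finite-dimensional and structural auxiliaries *)

(** The existence of J bounds the dimension of H by k without a basis of H: if s
    is a linear section of th, then J o s is an injective endomorphism of the
    space of rows, hence bijective, so every h is some s v. *)
Lemma surj_inj_of_embedding (F : fieldType) (H : lmodType F) k (th J : H -> 'rV[F]_k) :
  linear th -> linear J -> (forall v, exists h, v = th h) -> injective J ->
  injective th.
Proof.
move=> thl Jl /boolp.choice [g hg] Ji.
pose s (v : 'rV[F]_k) : H := \sum_j v 0 j *: g (delta_mx 0 j).
have sl : linear s.
  move=> a u v; rewrite /s scaler_sumr -big_split; apply: eq_bigr => j _ /=.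
  by rewrite !mxE scalerDl scalerA.
have ths v : th (s v) = v.
  rewrite [RHS]row_sum_delta (big_morph th (fun x y => linD x y thl) (lin0 thl)).
  by apply: eq_bigr => j _; rewrite (linZ _ _ thl) -hg.
have Tl : linear (J \o s) by move=> a u v; rewrite /= sl Jl.
pose T : {linear 'rV[F]_k -> 'rV[F]_k} :=
  HB.pack (J \o s) (GRing.isLinear.Build _ _ _ _ (J \o s) Tl).
have TE v : v *m lin1_mx T = J (s v) by rewrite mul_rV_lin1.
have Tu : lin1_mx T \in unitmx.
  rewrite -row_free_unit; apply: inj_row_free => v.
  rewrite TE => hv; have /Ji e : J (s v) = J 0 by rewrite hv (lin0 Jl).
  by rewrite -(ths v) e (lin0 thl).
have sth h : h = s (th h).
  suff [v ->] : exists v, h = s v by rewrite ths.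
  by exists (J h *m invmx (lin1_mx T)); apply: Ji; rewrite -TE mulmxKV.
by move=> x y e; rewrite (sth x) (sth y) e.
Qed.

Section Regular.
Variables (F : fieldType) (A : superalg F).

Fact reg_actl (m : A) : linear (fun a : A => a * m).
Proof. by move=> k a b; rewrite mulrDl scalerAl. Qed.
Fact reg_actr (a : A) : linear (fun m : A => a * m).
Proof. by move=> k u v; rewrite mulrDr scalerAr. Qed.

Definition regular : smodule A :=
  @SModule F A A (@sa_part F A) (fun a m => a * m) (sa_graded A) reg_actl reg_actr
    (@mul1r A) (fun a b m => esym (mulrA a b m)) (@sa_partM F A).

End Regular.

Section PullbackAlong.
Variables (F : fieldType) (A B : superalg F) (h : superhom A B).
Hypothesis hsurj : forall y, exists x, h x = y.

Lemma pullback_simple (M : smodule B) : simple_module M -> simple_module (pullback h M).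
Proof.
move=> [nz sM]; split=> // p [ps pa pg]; apply: sM; split=> // b m pm.
by have [a <-] := hsurj b; apply: pa.
Qed.

(** Every homogeneous element of B lifts to a homogeneous element of A of the same
    parity: take the component of that parity of any lift. *)
Lemma pullback_homog (M N : smodule B) e (f : M -> N) :
  @homog_hom F A (pullback h M) (pullback h N) e f <-> @homog_hom F B M N e f.
Proof.
split=> [[fl fp fa]|[fl fp fa]]; split=> // b y m hy.
  have [x ex] := hsurj y.
  have [x0 [x1 [h0 h1 e0]]] := graded_sum (sa_graded A) x.
  have z d := sub0 (graded_sub (sa_graded B) d).
  have [x' hx' ->] : exists2 x', sa_part b x' & y = h x'.
    move: ex; rewrite e0 (linD _ _ (sh_linear h)) => ex.
    have k0 := sh_part h h0; have k1 := sh_part h h1.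
    case: b hy => hy.
      by exists x1 => //; apply: (graded_uniq (sa_graded B) (z _) hy k0 k1 _).2; rewrite add0r.
    by exists x0 => //; apply: (graded_uniq (sa_graded B) hy (z _) k0 k1 _).1; rewrite addr0.
  exact: fa.
by apply: fa; apply: sh_part.
Qed.

End PullbackAlong.

Section PresentedHom.
Variables (F : fieldType) (two_neq0 : 2%:R != 0 :> F) (P : presentation F).
Variable tnegP : forall s t, @rels F P s t -> cong (@rels F P) (tneg s) (tneg t).
Local Notation B := (psalg two_neq0 tnegP).

(** The sign rule for a product of generators follows from that for each
    generator, since the exponents add. *)
Lemma homog_hom_gen (M N : smodule B) e (f : M -> N) : linear f ->
  (forall b m, sm_part b m -> sm_part (b (+) e) (f m)) ->
  (forall x m, f (sm_act (pgen P x : B) m)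
     = (-1) ^+ e *: sm_act (pgen P x : B) (f m)) -> homog_hom e f.
Proof.
move=> fl fp fg; split=> // b _ m [t ht ->].
elim: ht m => {b t} [x|c||b s t _ hs _ ht|b c s t _ hs _ ht] m.
- by rewrite andbT; apply: fg.
- rewrite andbF scale1r pclsC !(linZ _ _ (sm_actl _)) (linZ _ _ fl).
  by rewrite !(sm_act1 (s := M), sm_act1 (s := N)).
- by rewrite pclsC scale0r !(lin0 (sm_actl _)) (lin0 fl) scaler0.
- by rewrite pclsD !(linD _ _ (sm_actl _)) (linD _ _ fl) hs ht scalerDr.
- rewrite pclsM !(sm_actM (A := B)) hs ht (linZ _ _ (sm_actr _)) scalerA.
  by rewrite -signr_addb -andb_addr.
Qed.

End PresentedHom.

(** * Words, scalar parts and graded simplicity of the Clifford algebra *)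

Section CliffordAlgebra.
Variables (F : fieldType) (n : nat) (two_neq0 : 2%:R != 0 :> F).
Local Notation A := (clifford n two_neq0).
Local Notation iota := (@cliff_iota F n two_neq0).

Definition cl_basis (i : 'I_n) : A := iota (delta_mx i 0).
Local Notation e := cl_basis.

Lemma iotaE v : iota v = \sum_i v i 0 *: e i.
Proof.
have il : linear iota by exact: cliff_gen_linear.
rewrite {1}(matrix_sum_delta v) (big_morph iota (fun x y => linD x y il) (lin0 il)).
by apply: eq_bigr => i _; rewrite big_ord1 (linZ _ _ il).
Qed.

Lemma par_iota v : par_alg A (iota v) = - iota v.
Proof.
by rewrite (par_homog _ (palg_part_gen (P := cliff_pres F n) v)) scaleN1r.
Qed.

Lemma par_basis i : par_alg A (e i) = - e i.
Proof. exact: par_iota. Qed.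

Lemma parD (x y : A) : par_alg A (x + y) = par_alg A x + par_alg A y.
Proof. exact: linD (par_linear _). Qed.

Lemma parZ a (x : A) : par_alg A (a *: x) = a *: par_alg A x.
Proof. exact: linZ (par_linear _). Qed.

Lemma par_scalar a : par_alg A a%:A = a%:A.
Proof. by rewrite parZ par1. Qed.

Lemma basis_sqr i : e i * e i = 1.
Proof.
have := cliff_genE (delta_mx i 0 : 'cV[F]_n) (delta_mx i 0).
rewrite -[pgen _ _]/(e i) /dotp trmx_delta mul_delta_mx mxE !eqxx mulr1.
rewrite -mulr2n -scaler_nat => /(congr1 (fun x => 2%:R^-1 *: x)).
by rewrite !scalerA mulVf // !scale1r.
Qed.

Lemma basis_anti i j : i != j -> e i * e j = - (e j * e i).
Proof.
move=> hij; apply/eqP; rewrite -addr_eq0.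
have := cliff_genE (delta_mx i 0 : 'cV[F]_n) (delta_mx j 0).
rewrite -![pgen _ _]/(e _) /dotp trmx_delta mul_delta_mx_cond (negPf hij) mulr0n.
by rewrite mxE mulr0 scale0r => ->.
Qed.

Lemma basisK i x : e i * (e i * x) = x.
Proof. by rewrite mulrA basis_sqr mul1r. Qed.

(** Induction principle: the Clifford algebra is spanned by the products of
    vectors. *)
Lemma cliff_ind (Q : A -> Prop) : Q 1 ->
  (forall a x y, Q x -> Q y -> Q (a *: x + y)) ->
  (forall v x, Q x -> Q (iota v * x)) -> forall x, Q x.
Proof.
move=> Q1 QD Qv.
have Q0 : Q 0 by have := QD (-1) _ _ Q1 Q1; rewrite scaleN1r addNr.
have h (t : term F 'cV[F]_n) : forall x, Q x -> Q ((pcls (P := cliff_pres F n) t : A) * x).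
  elim: t => [v|c|s hs t ht|s hs t ht] x hx.
  - exact: Qv.
  - rewrite pclsC mulr_algl -[c *: x]addr0; exact: QD.
  - by rewrite pclsD mulrDl -[_ * x]scale1r; apply: QD; [apply: hs|apply: ht].
  - by rewrite pclsM -mulrA; apply/hs/ht.
by move=> x; rewrite -(preprK (x : palg (cliff_pres F n))) -[pcls _]mulr1; apply: h.
Qed.

Lemma cliff_ind_basis (Q : A -> Prop) : Q 1 ->
  (forall a x y, Q x -> Q y -> Q (a *: x + y)) ->
  (forall i x, Q x -> Q (e i * x)) -> forall x, Q x.
Proof.
move=> Q1 QD Qe; have Q0 : Q 0 by have := QD (-1) _ _ Q1 Q1; rewrite scaleN1r addNr.
apply: cliff_ind => // v x hx; rewrite iotaE mulr_suml.
apply: (big_ind Q) => // [y z hy hz|i _]; first by rewrite -[y]scale1r; apply: QD.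
by rewrite -scalerAl -[_ *: _]addr0; apply: QD => //; apply: Qe.
Qed.

(** For s without repetitions, the subalgebra generated by the e_i with i in s, in
    the normal form with the letters in the order of s. The recursion by the first
    letter replaces a basis of monomials indexed by subsets. *)
Fixpoint words (s : seq 'I_n) (x : A) : Prop :=
  if s is i :: s' then
    exists y z, [/\ words s' y, words s' z & x = y + e i * z]
  else exists c, x = c%:A.

Lemma words_sub s : subspace (words s).
Proof.
elim: s => [|i s [h0 hD]].
  split=> [|a _ _ [c ->] [d ->]]; first by exists 0; rewrite scale0r.
  by exists (a * c + d); rewrite scalerDl scalerA.
split=> [|a _ _ [y [z [hy hz ->]]] [y' [z' [hy' hz' ->]]]].
  by exists 0, 0; rewrite mulr0 addr0.
exists (a *: y + y'), (a *: z + z'); split; try exact: hD.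
by rewrite mulrDr scalerDr -scalerAr addrACA.
Qed.

Lemma words_cons i s x : words s x -> words (i :: s) x.
Proof.
by move=> h; exists x, 0; split; rewrite ?mulr0 ?addr0 //; apply: sub0 (words_sub s).
Qed.

Lemma words_basis s i x : uniq s -> i \in s -> words s x -> words s (e i * x).
Proof.
elim: s x => [//|j s IH] x /= /andP[hj us] hi [y [z [hy hz ->]]].
have [ej|nij] := eqVneq i j.
  by exists z, y; split=> //; rewrite ej mulrDr basisK addrC.
rewrite inE (negPf nij) in hi.
exists (e i * y), (- (e i * z)); split; try exact: IH.
  by apply: subN (words_sub s) _; apply: IH.
by rewrite mulrDr mulrN !mulrA basis_anti // mulNr.
Qed.

Lemma words_par s x : words s x -> words s (par_alg A x).
Proof.
elim: s x => [|i s IH] x; first by case=> c ->; exists c; rewrite par_scalar.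
move=> [y [z [hy hz ->]]]; exists (par_alg A y), (- par_alg A z); split; try exact: IH.
  by apply: subN (words_sub s) _; apply: IH.
by rewrite parD parM par_basis mulNr mulrN.
Qed.

(** e_i anticommutes with every letter of x, and par collects these signs. *)
Lemma words_super s i x : words s x -> i \notin s -> e i * par_alg A x = x * e i.
Proof.
elim: s x => [|j s IH] x; first by case=> c -> _; rewrite par_scalar mulr_algl mulr_algr.
move=> [y [z [hy hz ->]]]; rewrite inE negb_or => /andP[nij hi].
rewrite parD parM par_basis mulrDr mulrDl (IH _ hy hi) mulNr mulrN !mulrA basis_anti //.
by rewrite mulNr opprK -!mulrA (IH _ hz hi).
Qed.

Lemma words_all x : words (enum 'I_n) x.
Proof.
elim/cliff_ind_basis: x => [|a x y hx hy|i x hx].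
- elim: (enum _) => [|i s h]; last exact: words_cons.
  by exists 1; rewrite scale1r.
- exact: (words_sub _).2.
- by apply: words_basis; rewrite ?enum_uniq ?mem_enum.
Qed.

(** Half the sum of the identity and of the super-conjugation by e_i: it fixes the
    monomials without e_i and kills those with e_i. *)
Definition drop_letter (i : 'I_n) (x : A) : A :=
  2%:R^-1 *: (x + e i * par_alg A x * e i).

Lemma drop_letter_linear i : linear (drop_letter i).
Proof.
move=> a x y; rewrite /drop_letter scalerA mulrC -scalerA -scalerDr; congr (_ *: _).
rewrite scalerDr [RHS]addrACA parD parZ mulrDr mulrDl.
by rewrite -scalerAr -scalerAl.
Qed.

Lemma dbl_half (x : A) : 2%:R^-1 *: (x + x) = x.
Proof. by rewrite -mulr2n -scaler_nat scalerA mulVf // scale1r. Qed.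

(** Conjugation acts on x by the sign + and on e_i y by the sign -, as neither x
    nor y contains e_i. *)
Lemma drop_letter_word i s x y : i \notin s -> words s x -> words s y ->
  drop_letter i (x + e i * y) = x.
Proof.
move=> hi hx hy; have py : par_alg A y * e i = e i * y.
  by rewrite -{1}(basisK i (par_alg A y)) (words_super hy hi) -!mulrA basis_sqr mulr1.
rewrite /drop_letter parD parM par_basis mulrDr mulrDl (words_super hx hi).
rewrite -[x * e i * e i]mulrA basis_sqr mulr1 mulNr mulrN basisK mulNr py.
by rewrite addrACA subrr addr0 dbl_half.
Qed.

(** Multiplication by e_i exchanges the monomials with and without e_i. *)
Lemma drop_letter_basis i x : drop_letter i (e i * x) = e i * (x - drop_letter i x).
Proof.
rewrite /drop_letter parM par_basis mulNr mulrN basisK mulNr.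
have -> : x - 2%:R^-1 *: (x + e i * par_alg A x * e i)
    = 2%:R^-1 *: (x - e i * par_alg A x * e i).
  rewrite -{1}(dbl_half x) -scalerBr; congr (_ *: _).
  by rewrite opprD addrA addrK.
by rewrite -scalerAr; congr (_ *: _); rewrite mulrBr -mulrA basisK.
Qed.

Lemma drop_letter_mull i s a x : i \notin s -> words s a ->
  drop_letter i (a * x) = a * drop_letter i x.
Proof.
move=> hi ha; rewrite /drop_letter parM -scalerAr; congr (_ *: _).
rewrite mulrDr; congr (_ + _).
by rewrite mulrA (words_super ha hi) !mulrA.
Qed.

Lemma drop_letter_par i x : drop_letter i (par_alg A x) = par_alg A (drop_letter i x).
Proof.
by rewrite /drop_letter parZ parD !parM par_basis mulNr mulrN mulNr opprK.
Qed.

Fixpoint drop_letters (s : seq 'I_n) (x : A) : A :=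
  if s is i :: s' then drop_letters s' (drop_letter i x) else x.

Lemma drop_letters_linear s : linear (drop_letters s).
Proof. by elim: s => [|i s IH] a x y //=; rewrite drop_letter_linear IH. Qed.

Lemma drop_letters_par s x : drop_letters s (par_alg A x) = par_alg A (drop_letters s x).
Proof. by elim: s x => [|i s IH] x //=; rewrite drop_letter_par IH. Qed.

Lemma drop_letters_scalar s x : uniq s -> words s x -> exists c, drop_letters s x = c%:A.
Proof.
elim: s x => [|i s IH] x //= /andP[hi us] [y [z [hy hz ->]]].
by rewrite (drop_letter_word hi hy hz); apply: IH.
Qed.

(** Either x or e_i x has a nonzero component without e_i; a multiplier chosen
    among the words in the remaining letters is not affected by dropping e_i. *)
Lemma drop_letters_nondegenerate s x : uniq s -> x != 0 ->
  exists2 a, words s a & drop_letters s (a * x) != 0.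
Proof.
elim: s x => [|i s IH] x /= => [_ nx|/andP[hi us] nx].
  by exists 1; [exists 1; rewrite scale1r | rewrite mul1r].
have [z|nz] := eqVneq (drop_letter i x) 0.
  have nex : e i * x != 0 by apply: contraNneq nx => h; rewrite -(basisK i x) h mulr0.
  have [a ha hd] := IH _ us nex; exists (a * e i).
    have -> : a * e i = e i * par_alg A a by rewrite (words_super ha hi).
    exists 0, (par_alg A a); rewrite add0r; split=> //; last exact: words_par.
    exact: sub0 (words_sub s).
  by rewrite -mulrA (drop_letter_mull _ hi ha) drop_letter_basis z subr0.
have [a ha hd] := IH _ us nz; exists a; first exact: words_cons.
by rewrite (drop_letter_mull _ hi ha).
Qed.

Lemma scalar_part_exists x : exists c, drop_letters (enum 'I_n) x = c%:A.
Proof. exact: drop_letters_scalar (enum_uniq _) (words_all x). Qed.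

(** The coefficient of 1, which serves as a trace form. *)
Definition scalar_part (x : A) : F := projT1 (cid (scalar_part_exists x)).

Lemma scalar_partE x : drop_letters (enum 'I_n) x = (scalar_part x)%:A.
Proof. exact: projT2 (cid (scalar_part_exists x)). Qed.

Lemma scalarA_inj : injective (fun c : F => c%:A : A).
Proof.
move=> a b /eqP; rewrite -subr_eq0 -scalerBl scaler_eq0 oner_eq0 orbF subr_eq0.
by move/eqP.
Qed.

Lemma scalar_part_linear : linear (scalar_part : A -> F^o).
Proof.
move=> a x y; apply: scalarA_inj; rewrite -scalar_partE drop_letters_linear !scalar_partE.
by rewrite scalerDl scalerA.
Qed.

Lemma scalar_part_par x : scalar_part (par_alg A x) = scalar_part x.
Proof.
by apply: scalarA_inj; rewrite -!scalar_partE drop_letters_par scalar_partE par_scalar.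
Qed.

(** The parity automorphism changes the sign of x but not its scalar part. *)
Lemma scalar_part_odd (x : A) : sa_part true x -> scalar_part x = 0.
Proof.
move=> /(par_homog (sa_graded A)) hx; have := scalar_part_par x.
rewrite hx scaleN1r (linN _ scalar_part_linear) => /eqP.
rewrite eq_sym -addr_eq0 -mulr2n -mulr_natl mulf_eq0 (negPf two_neq0).
by move/eqP.
Qed.

Lemma scalar_part_nondegenerate x : (forall a, scalar_part (a * x) = 0) -> x = 0.
Proof.
move=> h; apply/eqP; apply: contraT => nx.
have [a _] := drop_letters_nondegenerate (enum_uniq 'I_n) nx.
by rewrite scalar_partE h scale0r eqxx.
Qed.

(** The hypothesis says that dropping any letter fixes z; dropping all of them
    leaves the scalar part. *)
Lemma supercentral_scalar z : (forall i, e i * par_alg A z = z * e i) ->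
  exists c, z = c%:A.
Proof.
move=> h; have [c hc] := scalar_part_exists z; exists c; rewrite -hc.
elim: (enum _) => [|i s IH] //=.
by rewrite [drop_letter i z]/drop_letter h -mulrA basis_sqr mulr1 dbl_half.
Qed.

(** Dropping a letter preserves two-sided graded ideals, so from a nonzero x one
    reaches a nonzero scalar multiple of 1: multiply x so that its scalar part
    is nonzero, then drop all letters. *)
Lemma cliff_simple (p : A -> Prop) : subspace p ->
  (forall x, p x -> p (par_alg A x)) -> (forall a x, p x -> p (a * x)) ->
  (forall x i, p x -> p (x * e i)) -> forall x, x != 0 -> p x -> forall y, p y.
Proof.
move=> ps pp pl pr x nx px; have p1 : p 1; last by move=> y; rewrite -(mulr1 y); exact: pl.
have [a _ na] := drop_letters_nondegenerate (enum_uniq 'I_n) nx.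
have pd s y : p y -> p (drop_letters s y).
  elim: s y => [|i s IH] y py //=; apply: IH; apply: subZ => //; apply: subD => //.
  exact/pr/pl/pp.
have := pd (enum 'I_n) _ (pl a _ px); rewrite scalar_partE in na *.
rewrite scaler_eq0 negb_or in na; case/andP: na => na _.
move/(subZ (scalar_part (a * x))^-1 ps).
by rewrite scalerA mulVf // scale1r.
Qed.

(** The annihilator is a two-sided graded ideal that does not contain 1. *)
Lemma cliff_faithful (M : smodule A) a : (exists m : M, m <> 0) ->
  (forall m : M, sm_act a m = 0) -> a = 0.
Proof.
move=> [m0 nz] ha; apply/eqP; apply: contraT => na.
case: nz; rewrite -(sm_act1 m0).
apply: (@cliff_simple (fun x : A => forall m : M, sm_act x m = 0) _ _ _ _ a na ha 1).
- split=> [m|c x y hx hy m]; first exact: lin0 (sm_actl m).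
  by rewrite sm_actl hx hy scaler0 addr0.
- move=> x hx m; rewrite -[m](parK (sm_graded M)) -par_act hx.
  exact: lin0 (par_linear _).
- by move=> b x hx m; rewrite sm_actM hx (lin0 (sm_actr _)).
- by move=> x i hx m; rewrite sm_actM hx.
Qed.

End CliffordAlgebra.

(** * The volume element and odd endomorphisms *)

Section Volume.
Variables (F : fieldType) (n : nat) (two_neq0 : 2%:R != 0 :> F).
Local Notation A := (clifford n two_neq0).
Local Notation iota := (@cliff_iota F n two_neq0).
Local Notation e := (@cl_basis F n two_neq0).

Definition volume (s : seq 'I_n) : A := \prod_(i <- s) e i.

(** Moving e_i across a product of letters costs one sign for each letter other
    than e_i. *)
Lemma basis_volume i s : uniq s ->
  e i * volume s = (-1) ^+ (odd (size s) (+) (i \in s)) *: (volume s * e i).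
Proof.
rewrite /volume; elim: s => [|j s IH] /=; first by rewrite big_nil scale1r mulr1 mul1r.
move=> /andP[hj us]; rewrite !big_cons inE; have IHs := IH us.
set V := \prod_(_ <- s) _ in IHs *; have [ij|nij] /= := eqVneq i j.
  have hV : V * e i = (-1) ^+ odd (size s) *: (e i * V).
    by rewrite IHs ij (negPf hj) addbF scalerA -signr_addb addbb scale1r.
  rewrite -mulrA hV -ij -scalerAr scalerA -signr_addb.
  by rewrite addbT negbK addbb scale1r.
rewrite mulrA (basis_anti two_neq0 nij) mulNr -[e j * e i * V]mulrA IHs.
rewrite -scalerAr mulrA -scaleNr.
by rewrite -[- _]mulN1r -[-1 * _](signr_addb _ true) addNb.
Qed.

Lemma volume_part s : sa_part (odd (size s)) (volume s).
Proof.
rewrite /volume; elim: s => [|j s IH] /=; first by rewrite big_nil; exact: (sa_part1 A).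
rewrite big_cons -addTb; apply: (@sa_partM F A); last exact: IH.
exact: (palg_part_gen (P := cliff_pres F n)).
Qed.

Lemma volume_unit s : exists w, w * volume s = 1.
Proof.
rewrite /volume; elim: s => [|j s [w hw]].
  by exists 1; rewrite big_nil mulr1.
by exists (w * e j); rewrite big_cons -mulrA basisK.
Qed.

Local Notation w := (volume (enum 'I_n)).

Lemma volume_comm b (a : A) : sa_part b a ->
  w * par_alg A a = (-1) ^+ (odd n && b) *: (a * w).
Proof.
move=> ha; rewrite (par_homog _ ha) -scalerAr.
have he i : e i * w = (-1) ^+ (~~ odd n) *: (w * e i).
  by rewrite basis_volume ?enum_uniq // mem_enum size_enum_ord addbT.
have hv v : w * iota v = (-1) ^+ (~~ odd n) *: (iota v * w).
  rewrite iotaE mulr_sumr mulr_suml scaler_sumr; apply: eq_bigr => i _.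
  rewrite -scalerAr -scalerAl he !scalerA mulrC mulrA -signr_addb addbb.
  by rewrite mul1r.
have -> : w * a = (-1) ^+ (~~ odd n && b) *: (a * w).
  exact: (@psuper_comm F two_neq0 (cliff_pres F n) (@cliff_tneg F n) A
    (sh_id A) w _ hv b a ha).
by rewrite scalerA -signr_addb; case: (odd n) (b) => [] [].
Qed.

(** The action of the product of all e_i, with the sign that makes it a module
    homomorphism in the super sense. Its parity is that of n, which is what
    separates the types M and Q. *)
Definition volume_map (M : smodule A) (m : M) : M := sm_act w (par_mod M m).

Lemma volume_hom (M : smodule A) : homog_hom (odd n) (@volume_map M).
Proof.
split=> [a u v|b m hm|b a m ha]; rewrite /volume_map.
- by rewrite (par_linear _) sm_actr.
- rewrite addbC (par_homog _ hm); apply: sm_act_part.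
    by rewrite -{2}[n]size_enum_ord; apply: volume_part.
  exact: subZ (graded_sub (sm_graded M) b) hm.
- rewrite par_act -sm_actM (volume_comm ha) (linZ _ _ (sm_actl _)).
  by rewrite sm_actM.
Qed.

Lemma volume_neq0 (M : smodule A) (m : M) : m <> 0 -> volume_map m <> 0.
Proof.
move=> nm h; apply: nm; have [u hu] := volume_unit (enum 'I_n).
rewrite -(parK (sm_graded M) m) -[par_mod M m]sm_act1 -hu sm_actM.
by rewrite -/(volume_map m) h (lin0 (sm_actr _)) (lin0 (par_linear _)).
Qed.

End Volume.

Section Even.
Variables (F : numClosedFieldType) (n : nat) (two_neq0 : 2%:R != 0 :> F).
Local Notation A := (clifford n two_neq0).

(** For even n the volume map is even, hence a nonzero scalar c. An odd f commutes
    with the action of the volume element up to sign, so it anticommutes with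
    the volume map: c f = - c f. *)
Lemma cliff_odd_hom_eq0 (M : smodule A) (f : M -> M) : ~~ odd n ->
  fin_dim M -> simple_module M -> homog_hom true f -> forall m, f m = 0.
Proof.
move=> en Mfin Ms hf; have hD := volume_hom M; rewrite (negPf en) in hD.
have [c hc] := schur_scalar Mfin Ms hD.
have c0 : c != 0.
  have [[m nm] _] := Ms; apply/eqP=> c0; apply: (volume_neq0 nm).
  by rewrite hc c0 scale0r.
move=> m; have fl := hh_linear hf.
have pw : par_alg A (volume two_neq0 (enum 'I_n)) = volume two_neq0 (enum 'I_n).
  by rewrite (par_homog _ (volume_part _ _)) size_enum_ord (negPf en) scale1r.
have : f (volume_map m) = - volume_map (f m).
  rewrite /volume_map (hom_act _ _ hf) /= pw (hom_par _ hf) scaleN1r.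
  by rewrite (linN _ (sm_actr _)).
rewrite !hc (linZ _ _ fl) => /eqP; rewrite -addr_eq0 -mulr2n -scaler_nat.
by rewrite !scaler_eq0 (negPf two_neq0) (negPf c0) => /eqP.
Qed.

End Even.

(** * A nonzero homomorphism to the regular module *)

Section Averaging.
Variables (F : fieldType) (n : nat) (two_neq0 : 2%:R != 0 :> F).
Local Notation A := (clifford n two_neq0).
Local Notation e := (@cl_basis F n two_neq0).
Variable U : smodule A.

Section Functional.
Variable chi : U -> F^o.
Hypothesis chil : linear chi.

(** Sum of chi (w^-1 u) w over the monomials w in the letters s, the averaging of
    the functional chi over the group of monomials. The scalar part of the
    result is chi u, so averaging does not lose chi. *)
Fixpoint avg (s : seq 'I_n) (u : U) : A :=
  if s is i :: s' then avg s' u + e i * avg s' (sm_act (e i) u) else (chi u)%:A.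

Lemma avg_linear s : linear (avg s).
Proof.
elim: s => [|i s IH] a u v /=; first by rewrite chil scalerDl scalerA.
by rewrite sm_actr !IH mulrDr scalerDr -scalerAr addrACA.
Qed.

Lemma avg_words s u : words s (avg s u).
Proof.
by elim: s u => [|i s IH] u /=; [exists (chi u) | exists (avg s u), (avg s (sm_act (e i) u))].
Qed.

Lemma avg_drop_letters s u : uniq s -> drop_letters s (avg s u) = (chi u)%:A.
Proof.
elim: s u => [|i s IH] u //= /andP[hi us].
by rewrite (drop_letter_word hi) ?IH //; apply: avg_words.
Qed.

(** The two terms of the sum are exchanged by e_i if i is the first letter; the
    other letters anticommute with it. *)
Lemma avg_basis s i u : uniq s -> i \in s -> avg s (sm_act (e i) u) = e i * avg s u.
Proof.
elim: s u => [//|j s IH] u /= /andP[hj us]; rewrite inE.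
have [->|nij] /= := eqVneq i j => [_|hi].
  by rewrite -sm_actM basis_sqr sm_act1 mulrDr basisK addrC.
rewrite IH // mulrDr -[sm_act (e j) _]sm_actM basis_anti 1?eq_sym //.
rewrite (linN _ (sm_actl _)) sm_actM (linN _ (avg_linear s)) IH //.
by rewrite mulrN !mulrA (basis_anti two_neq0 nij) mulNr.
Qed.

Lemma avg_act a u : avg (enum 'I_n) (sm_act a u) = a * avg (enum 'I_n) u.
Proof.
elim/cliff_ind_basis: a u => [|c x y hx hy|i x hx] u.
- by rewrite sm_act1 mul1r.
- by rewrite sm_actl avg_linear hx hy mulrDl scalerAl.
- by rewrite sm_actM avg_basis ?enum_uniq ?mem_enum // hx mulrA.
Qed.

Lemma avg_part p s b u : (forall c v, sm_part c v -> c != p -> chi v = 0) ->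
  sm_part b u -> sa_part (b (+) p) (avg s u).
Proof.
move=> hchi; have sb c := graded_sub (sa_graded A) c.
elim: s b u => [|i s IH] b u hu /=.
  have [->|nb] := eqVneq b p; first by rewrite addbb; apply: subZ (sb _) (sa_part1 _).
  by rewrite (hchi b) // scale0r; apply: sub0 (sb _).
have he : sa_part true (e i) by exact: (palg_part_gen (P := cliff_pres F n)).
apply: subD (sb _) _ _; first exact: IH.
have := sa_partM he (IH _ _ (sm_act_part he hu)).
by rewrite addTb addNb negbK.
Qed.

End Functional.

(** Average a nonzero homogeneous functional. If it is odd, composing with the
    parity involution turns the commutation with A into the super one. *)
Lemma regular_hom : fin_dim U -> (exists u : U, u <> 0) ->
  exists p (f : U -> regular A), homog_hom p f /\ exists u, f u <> 0.
Proof.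
move=> [k [b [bl [b' bK _]]]] [m nm].
have [p [u [hu nu]]] : exists p (u : U), sm_part p u /\ u <> 0.
  have [u0 [u1 [h0 h1 em]]] := graded_sum (sm_graded U) m.
  have [z|/eqP nz] := eqVneq u0 0; last by exists false, u0.
  by exists true, u1; split=> // z1; apply: nm; rewrite em z z1 addr0.
have [j nj] : exists j, b u 0 j != 0.
  apply/existsP; apply: contra_notT nu => /existsPn h; apply: (can_inj bK).
  by rewrite (lin0 bl); apply/rowP=> j; rewrite mxE; apply/eqP/negPn/h.
pose chi v : F^o := b (v + (-1) ^+ p *: par_mod U v) 0 j.
have chil : linear chi.
  move=> a x y; rewrite /chi (par_linear _) !(linD _ _ bl, linZ _ _ bl) !mxE.
  by rewrite /GRing.scale /= !mulrDr !mulrA [a * (-1) ^+ p]mulrC addrACA.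
have hchi c v : sm_part c v -> c != p -> chi v = 0.
  move=> hv ncp; rewrite /chi (par_homog _ hv) scalerA -signr_addb.
  have -> : p (+) c by case: (p) (c) ncp => [] [].
  by rewrite scaleN1r subrr (lin0 bl) mxE.
have pi : linear (iter p (par_mod U)) by case: (p) => //; apply: par_linear.
exists p, (fun v => avg chi (enum 'I_n) (iter p (par_mod U) v)); split; last first.
  exists (iter p (par_mod U) u) => h.
  have : chi u = 0.
    apply: (@scalarA_inj F n two_neq0); rewrite scale0r.
    rewrite -(avg_drop_letters chi u (enum_uniq 'I_n)).
    suff -> : u = iter p (par_mod U) (iter p (par_mod U) u).
      by rewrite h (lin0 (drop_letters_linear _)).
    by case: (p) => //=; rewrite parK.
  rewrite /chi (par_homog _ hu) scalerA -signr_addb addbb scale1r.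
  rewrite -mulr2n -scaler_nat (linZ _ _ bl) mxE => /eqP.
  by rewrite mulf_eq0 (negPf two_neq0) (negPf nj).
split=> [a x y|c v hv|c a v ha].
- by rewrite pi (avg_linear chil).
- apply: avg_part => //; case: (p) => //=; rewrite (par_homog _ hv).
  exact: subZ (graded_sub (sm_graded U) c) hv.
- case: (p) => /=; last by rewrite (avg_act chil) scale1r.
  by rewrite par_act (avg_act chil) (par_homog _ ha) -scalerAl.
Qed.

End Averaging.

(** * The reversal anti-automorphism *)

Section Reversal.
Variables (F : fieldType) (n : nat) (two_neq0 : 2%:R != 0 :> F).
Local Notation A := (clifford n two_neq0).
Local Notation iota := (@cliff_iota F n two_neq0).

Definition rmul_gen (v : 'cV[F]_n) (x : A) : A := x * iota v.

(** The anti-automorphism that fixes the vectors, obtained by letting a product of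
    vectors act on 1 by right multiplications. *)
Definition reversal (a : A) : A := tact rmul_gen (prepr (a : palg (cliff_pres F n))) 1.

Let rmul_linear v : linear (rmul_gen v).
Proof. by move=> a x y; rewrite /rmul_gen mulrDl scalerAl. Qed.

Let rmul_rel s t : cliff_rel s t -> tact rmul_gen s =1 tact rmul_gen t.
Proof.
case=> {s t} [a u v|v w] x; rewrite /= /rmul_gen.
  by rewrite /cliff_iota cliff_gen_linear mulrDr scalerAr.
rewrite -!mulrA -mulrDr addrC /cliff_iota cliff_genE.
by rewrite -scalerAr mulr1.
Qed.

Let reversal_cls t : reversal (pcls (P := cliff_pres F n) t) = tact rmul_gen t 1.
Proof.
by apply: (tact_cong rmul_linear rmul_rel); apply: (@prepr_cong F (cliff_pres F n)).
Qed.

Lemma reversal1 : reversal 1 = 1.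
Proof. by rewrite -[1 in LHS]/(pcls (TConst 1)) reversal_cls /= scale1r. Qed.

Lemma reversal_linear : linear reversal.
Proof.
move=> a; elim/palg_ind=> s; elim/palg_ind=> t.
by rewrite -mulr_algl -pclsC -pclsM -pclsD !reversal_cls.
Qed.

Lemma reversal_iota v x : reversal (iota v * x) = reversal x * iota v.
Proof.
elim/palg_ind: x => t.
by rewrite -[iota v]/(@pcls F (cliff_pres F n) (TVar v)) -pclsM !reversal_cls.
Qed.

Lemma reversalM x y : reversal (x * y) = reversal y * reversal x.
Proof.
elim/cliff_ind: x => [|a x z hx hz|v x hx].
- by rewrite reversal1 mul1r mulr1.
- by rewrite mulrDl -scalerAl !reversal_linear hx hz mulrDr scalerAr.
- by rewrite -mulrA !reversal_iota hx mulrA.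
Qed.

Lemma reversal_gen v : reversal (iota v) = iota v.
Proof. by rewrite -[iota v]mulr1 reversal_iota reversal1 mul1r mulr1. Qed.

Lemma reversalK : involutive reversal.
Proof.
elim/cliff_ind=> [|a x y hx hy|v x hx]; first by rewrite !reversal1.
  by rewrite !reversal_linear hx hy.
by rewrite reversal_iota reversalM reversal_gen hx.
Qed.

Lemma reversal_par x : reversal (par_alg A x) = par_alg A (reversal x).
Proof.
elim/cliff_ind: x => [|a x y hx hy|v x hx]; first by rewrite par1 reversal1 par1.
  by rewrite reversal_linear !(par_linear (sa_graded A)) reversal_linear hx hy.
rewrite reversal_iota !parM par_iota reversalM (linN _ reversal_linear).
by rewrite reversal_gen hx mulrN.
Qed.

Lemma reversal_part b x : sa_part b x -> sa_part b (reversal x).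
Proof.
move=> /(homogP (sa_graded A)) h; apply/(homogP (sa_graded A)) => //.
by rewrite -reversal_par h // (linZ _ _ reversal_linear).
Qed.

End Reversal.

(** * The spin Weyl group algebra *)

Section Spin.
Variables (R : realType) (W : weyl_group R).
Local Notation C := R[i].
Local Notation n := (rank W).
Local Notation toC := (real_complex R).
Local Notation two := (@two_neq0C R).
Local Notation A := (clV W).
Local Notation iota := (@cliff_iota C n two).

(** The simple roots form a basis of the real space, and the e_k are real vectors. *)
Lemma basis_beta k : exists c : 'I_n -> C, cl_basis two k = \sum_j c j *: beta j.
Proof.
have [_ hb _] := sroot_simple W.
pose nrm j : R := Num.sqrt (dotp (tnth (sroot W) j) (tnth (sroot W) j)).
have nrm0 j : nrm j != 0 by rewrite gt_eqF // sqrtr_gt0 al_gt0.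
pose c j : R := coord (sroot W) j (delta_mx k 0) * nrm j.
exists (fun j => toC (c j)).
have il : linear iota by exact: cliff_gen_linear.
rewrite /cl_basis; have -> : delta_mx k 0 = \sum_j toC (c j) *: unit_root j :> 'cV[C]_n.
  have e : delta_mx k 0 = \sum_j c j *: ((nrm j)^-1 *: tnth (sroot W) j) :> 'cV[R]_n.
    rewrite [LHS](coord_basis hb (memvf _)); apply: eq_bigr => j _.
    by rewrite scalerA /c mulfK // (tnth_nth 0).
  rewrite -(map_delta_mx toC) e map_mx_sum; apply: eq_bigr => j _.
  by rewrite map_mxZ.
rewrite (big_morph iota (fun x y => linD x y il) (lin0 il)).
by apply: eq_bigr => j _; rewrite (linZ _ _ il).
Qed.

Lemma basis_of_beta (Q : A -> Prop) : subspace Q -> (forall i, Q (beta i)) ->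
  forall k, Q (cl_basis two k).
Proof.
move=> sQ hQ k; have [c ->] := basis_beta k.
by apply: big_ind => [|x y|j _]; [apply: sub0|apply: subD|apply: subZ].
Qed.

Lemma Omega_gen i : Omega W (spin_gen i) = beta i.
Proof. by rewrite /= plift_gen //; apply: Omega_respects. Qed.

(** This is where the simple roots spanning V matters: it reduces the statements on
    B_W to statements on U. *)
Lemma Omega_surj (x : A) : exists y, Omega W y = x.
Proof.
have ol := sh_linear (Omega W); have om := sh_monoid (Omega W).
elim/cliff_ind_basis: x => [|a x y [x' <-] [y' <-]|i x [x' <-]].
- by exists 1; rewrite om.1.
- by exists (a *: x' + y'); rewrite ol.
- have [y <-] : exists y, Omega W y = cl_basis two i.
    apply: (basis_of_beta (Q := fun z => exists y, Omega W y = z)) => [|j].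
      split=> [|a _ _ [u <-] [v <-]]; first by exists 0; rewrite (lin0 ol).
      by exists (a *: u + v); rewrite ol.
    by exists (spin_gen j); rewrite Omega_gen.
  by exists (y * x'); rewrite om.2.
Qed.

Section BasicSpin.
Variable U : smodule A.
Hypotheses (U_fin : fin_dim U) (U_simple : simple_module U).

Lemma basic_spin_simple : simple_module (basic_spin U).
Proof. exact (pullback_simple Omega_surj U_simple). Qed.

Lemma basic_spin_even (f : U -> U) :
  @homog_hom C (spin_alg W) (basic_spin U) (basic_spin U) false f ->
  exists c, forall m, f m = c *: m.
Proof. by move/(pullback_homog Omega_surj)/(schur_scalar U_fin U_simple). Qed.

Lemma basic_spin_typeM : ~~ odd n -> typeM (basic_spin U).
Proof.
move=> en; apply: typeM_of; first by have [] := U_simple.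
  exact: basic_spin_even.
move=> f /(pullback_homog Omega_surj) hf.
exact: cliff_odd_hom_eq0 hf.
Qed.

Lemma basic_spin_typeQ : odd n -> typeQ (basic_spin U).
Proof.
move=> on; have [[m nm] _] := U_simple.
have hD := volume_hom U; rewrite on in hD.
have nD : exists m : U, volume_map m <> 0 by exists m; apply: volume_neq0.
apply: (@typeQ_of C (spin_alg W) (basic_spin U) (@volume_map C n two U)) => //.
- exact/(pullback_homog Omega_surj).
- exact: basic_spin_even.
- move=> f /(pullback_homog Omega_surj) hf.
  exact: schur_odd hf.
Qed.

End BasicSpin.

(** * The module Cl_V over the Hecke-Clifford algebra *)

Lemma betaK (i : 'I_n) (x : A) : beta i * (beta i * x) = x.
Proof. by rewrite mulrA beta2 mul1r. Qed.

(** On a vector the reflection is - beta_i v beta_i, and both sides are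
    multiplicative since beta_i has square 1. *)
Lemma clV_map_srefl_par i (x : A) : clV_map (srefl i) x = beta i * par_alg A x * beta i.
Proof.
elim/cliff_ind: x => [|a x y hx hy|v x hx].
- by rewrite (sh_monoid _).1 par1 mulr1 beta2.
- by rewrite sh_linear hx hy parD parZ mulrDr mulrDl -scalerAr -scalerAl.
- rewrite (sh_monoid _).2 hx clV_map_srefl parM par_iota !mulNr mulrN mulNr.
  by rewrite -!mulrA betaK.
Qed.

Local Notation H := (hecke_clifford W).

Lemma clV_act_emb (a : A) (x : clV_module W) :
  sm_act (sd_emb (clV_aut W) a) x = a * x :> A.
Proof. by rewrite [LHS]sdact_elt aut1. Qed.

Lemma clV_act_refl i (x : clV_module W) :
  sm_act (sdelt (clV_aut W) 1 (srefl i) : H) x = beta i * par_alg A x * beta i :> A.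
Proof. by rewrite [LHS]sdact_elt mul1r -clV_map_srefl_par. Qed.

(** By the formula for the reflections, a graded submodule is a left ideal stable
    under right multiplication by the beta_i, that is, a two-sided ideal. *)
Lemma clV_module_simple : simple_module (clV_module W).
Proof.
split; first by exists (1 : A); apply/eqP/oner_neq0.
move=> p hp; have ps := gs_subspace hp.
have pl (a x : A) : p x -> p (a * x).
  by move=> /(gs_act hp (sd_emb (clV_aut W) a)); rewrite clV_act_emb.
have pp (x : A) : p x -> p (par_alg A x) by move=> px; apply: (submodule_par hp px).
have pb i (x : A) : p x -> p (x * beta i).
  move=> /pp /(gs_act hp (sdelt (clV_aut W) 1 (srefl i) : H)).
  by rewrite clV_act_refl parK => /(pl (beta i)); rewrite -mulrA betaK.
have [h|] := boolp.EM (forall m, p m -> m = 0); first by left.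
move=> /boolp.existsNP [x /boolp.not_implyP [px /eqP nx]]; right.
apply: (cliff_simple (p := p) _ pp pl _ nx px) => // y i py.
apply: (basis_of_beta (Q := fun z => p (y * z))) => [|j]; last exact: pb.
split=> [|a u v hu hv]; first by rewrite mulr0; apply: sub0 ps.
by rewrite mulrDr -scalerAr; apply: ps.2.
Qed.

(** f is determined by z = f 1. As 1 is fixed by W so is z, which by the formula for
    the reflections says that z is supercentral, hence a scalar; an odd scalar
    is 0. *)
Lemma clV_module_endo_scalar e (f : clV_module W -> clV_module W) : homog_hom e f ->
  exists2 c, e -> c = 0 & forall m, f m = c *: m.
Proof.
move=> hf; pose one : clV_module W := (1 : A); pose z : A := f one.
have fz (x : A) : f x = iter e (par_alg A) x * z.
  have := hom_act (sd_emb (clV_aut W) x) one hf.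
  rewrite clV_act_emb mulr1 => ->.
  have -> : iter e (par_alg H) (sd_emb (clV_aut W) x)
      = sd_emb (clV_aut W) (iter e (par_alg A) x).
    by case: (e); first exact: (sh_par (sd_emb (clV_aut W))).
  exact: clV_act_emb.
have pz : par_alg A z = (-1) ^+ e *: z.
  by apply: par_homog; apply: (hh_part hf (b := false)); apply: sa_part1.
have [c hc] : exists c, z = c%:A.
  apply: (supercentral_scalar (two_neq0 := two)) => i.
  apply: (basis_of_beta (Q := fun y => y * par_alg A z = z * y)) => [|j].
    split=> [|a u v hu hv]; first by rewrite mul0r mulr0.
    by rewrite mulrDl mulrDr -scalerAl -scalerAr hu hv.
  have : f (sm_act (sdelt (clV_aut W) 1 (srefl j) : H) one) = z.
    by rewrite clV_act_refl par1 mulr1 beta2.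
  rewrite (hh_act hf (b := false)); last exact/sdpart_elt/sa_part1.
  rewrite andbF scale1r clV_act_refl => {2}<-.
  by rewrite -mulrA beta2 mulr1.
case: e hf fz pz => hf fz pz; last first.
  by exists c => // m; rewrite [LHS]fz hc -scalerAr mulr1.
exists 0 => // m; suff z0 : z = 0 by rewrite [LHS]fz z0 mulr0 scale0r.
move: pz; rewrite scaleN1r hc par_scalar => /eqP.
by rewrite -addr_eq0 -mulr2n -scaler_nat scaler_eq0 pnatr_eq0 => /eqP.
Qed.

Lemma clV_module_typeM : typeM (clV_module W).
Proof.
apply: typeM_of; first by exists (1 : A); apply/eqP/oner_neq0.
  by move=> f /clV_module_endo_scalar [c _ hc]; exists c.
by move=> f /clV_module_endo_scalar [c c0 hc] m; rewrite hc c0 // scale0r.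
Qed.

(** * The spin module Hom(U, Cl_V) *)

Section FunctorG.
Variable U : smodule A.
Hypotheses (U_fin : fin_dim U) (U_simple : simple_module U).
Local Notation G := (functorG U (clV_module W)).
Local Notation NA := (pullback (sd_emb (clV_aut W)) (clV_module W)).

(** In sqrt(-1) beta_i s_i the left factor beta_i cancels against the one in
    s_i x = beta_i par(x) beta_i: the generators act by right multiplication. *)
Lemma functorG_clV_gen i (f : G) u :
  hom_fun (sm_act (spin_gen i) f) u
  = 'i%C *: (par_alg A (hom_fun f u : A) * beta i) :> A.
Proof.
rewrite functorG_gen; congr (_ *: _); rewrite [LHS]sdact_elt.
rewrite -[clV_aut W _ _]/(clV_map (srefl i) _) clV_map_srefl_par -mulrA.
by rewrite betaK.
Qed.

Lemma regular_homog_emb e (f : U -> A) :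
  @homog_hom C A U (regular A) e f <-> @homog_hom C A U NA e f.
Proof.
have act a (x : A) : sm_act (s := NA) a x = a * x :> A by apply: clV_act_emb.
split=> -[fl fp fa]; split=> // b a m ha.
  by rewrite (fa b) // act.
by rewrite (fa b) // act.
Qed.

(** Every scalar_part (a (f u)) is scalar_part (f u') for some u'. *)
Lemma scalar_part_separates_homog e (f : U -> NA) : homog_hom e f ->
  (forall u, scalar_part (f u : A) = 0) -> forall u, f u = 0.
Proof.
move=> hf h u; apply: (@scalar_part_nondegenerate C n two) => a.
have := h (sm_act (iter e (par_alg A) a) u); rewrite (hom_act _ _ hf).
rewrite [X in scalar_part X](clV_act_emb (iter e (par_alg A) (iter e (par_alg A) a)) (f u)).
by case: (e) => //=; rewrite parK.
Qed.

(** So Hom(U, Cl_V) embeds into the dual of U. For homogeneous u only one of the two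
    components of f can have a nonzero scalar part at u, which reduces the claim
    to homogeneous maps. *)
Lemma scalar_part_separates_homs (f : G) :
  (forall u, scalar_part (hom_fun f u : A) = 0) -> f = 0.
Proof.
move=> h; have [f0 [f1 [h0 h1 ef]]] := hom_spaceP f.
have zero e (g g' : U -> NA) : homog_hom e g -> homog_hom (~~ e) g' ->
    (forall u, hom_fun f u = g u + g' u) -> forall u, g u = 0.
  move=> hg hg' efg; apply: (scalar_part_separates_homog hg) => u.
  have hb b v : sm_part b v -> scalar_part (g v : A) = 0.
    move=> hv; have [ebe|nb] := eqVneq b e; last first.
      apply: scalar_part_odd; suff -> : true = b (+) e by apply: (hh_part hg).
      by case: (b) (e) nb => [] [].
    have := h v; rewrite efg (linD _ _ (@scalar_part_linear C n two)).
    rewrite (@scalar_part_odd C n two (g' v)) ?addr0 //.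
    suff -> : true = b (+) ~~ e by apply: (hh_part hg').
    by rewrite ebe; case: (e).
  have [v0 [v1 [k0 k1 ->]]] := graded_sum (sm_graded U) u.
  rewrite (linD _ _ (hh_linear hg)) (linD _ _ (@scalar_part_linear C n two)).
  by rewrite (hb _ _ k0) (hb _ _ k1) addr0.
apply: hom_space_ext => u; rewrite ef.
rewrite (zero _ _ _ h0 h1 ef) (zero true f1 f0) ?addr0 // => v.
by rewrite ef addrC.
Qed.

(** Twice the map x0 + x1 |-> x0 + c x1. It converts the twisted right action of
    the generators, after reversal, into left multiplication. *)
Definition parity_twist (c : C) (x : A) : A := (1 + c) *: x + (1 - c) *: par_alg A x.

Lemma parity_twist_linear c : linear (parity_twist c).
Proof.
move=> a x y; rewrite /parity_twist parD parZ !scalerDr !scalerA addrACA.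
by rewrite ![_ * a]mulrC.
Qed.

Lemma parity_twist_homog c b (x : A) : sa_part b x ->
  parity_twist c x = (2%:R * (if b then c else 1)) *: x.
Proof.
move=> hx; rewrite /parity_twist (par_homog _ hx) scalerA -scalerDl; congr (_ *: _).
by case: b {hx}; ring.
Qed.

Section Evaluation.
Variables (p1 p0 : bool) (u1 u0 : U).
Hypotheses (hu1 : sm_part p1 u1) (hu0 : sm_part p0 u0).
Local Notation eps := ((-1) ^+ (p1 (+) p0) : C).
Local Notation kappa := (parity_twist (- 'i%C * eps)).

(** Evaluation at u1 sends t_i f to sqrt(-1) par(f u1) beta_i; reversal and twist
    turn this into +- beta_i times the image of f u1, which acts on u0 as t_i
    does. For p1 (+) p0 odd the sign is the one of an odd homomorphism. *)
Definition eval_map (f : G) : basic_spin U :=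
  sm_act (kappa (reversal (hom_fun f u1 : A))) u0.

(** The equation that determines the constant: c must satisfy sqrt(-1) c = eps and
    eps c = - sqrt(-1). *)
Lemma parity_twist_beta i (y : A) :
  'i%C *: kappa (beta i * par_alg A y) = eps *: (beta i * kappa y).
Proof.
have e2 : eps * eps = 1 by rewrite -signr_addb addbb.
set c := - 'i%C * eps.
have ic : 'i%C * c = eps by rewrite /c mulNr mulrN mulrA -expr2 sqr_i mulN1r opprK.
have ec : eps * c = - 'i%C by rewrite /c mulrCA e2 mulr1.
have hp : par_alg A (beta i * par_alg A y) = - (beta i * y).
  by rewrite parM parK par_iota mulNr.
rewrite /parity_twist hp scalerN -scaleNr mulrDr -!scalerAr !scalerDr !scalerA.
by rewrite addrC; congr (_ *: _ + _ *: _); ring: ic ec.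
Qed.

Lemma eval_map_linear : linear eval_map.
Proof.
move=> a f g; rewrite /eval_map.
rewrite [hom_fun _ _]/(a *: hom_fun f u1 + hom_fun g u1).
by rewrite reversal_linear parity_twist_linear sm_actl.
Qed.

Lemma eval_map_hom : homog_hom (p1 (+) p0) eval_map.
Proof.
apply: homog_hom_gen => [|b f hf|i f].
- exact: eval_map_linear.
- rewrite addbA [b (+) p1]addbC; apply: (sm_act_part (s := U)) hu0.
  have hy : sa_part (p1 (+) b) (reversal (hom_fun f u1 : A)).
    by apply: reversal_part; apply: (hh_part hf).
  by rewrite (parity_twist_homog _ hy); apply: subZ (graded_sub (sa_graded A) _) hy.
- rewrite /eval_map [hom_fun _ _]functorG_clV_gen.
  rewrite (linZ _ _ (@reversal_linear C n two)) (linZ _ _ (parity_twist_linear _)).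
  rewrite reversalM reversal_gen reversal_par -/(beta i) parity_twist_beta.
  rewrite (linZ _ _ (sm_actl _)) sm_actM; congr (_ *: _).
  by rewrite [RHS]/(sm_act (Omega W (spin_gen i)) _) Omega_gen.
Qed.

End Evaluation.

(** For suitable u1 and u0 the map eval_map is nonzero, because there is a nonzero
    homogeneous homomorphism to Cl_V and Cl_V acts faithfully on U. It is onto
    because B_W is simple, and it is injective because Hom(U, Cl_V) is no larger
    than the dual of U. *)
Lemma functorG_iso : siso G (basic_spin U).
Proof.
have two_neq0 := two; have [[m nm] sU] := U_simple.
have split_hom (X : lmodType C) (g : U -> X) : linear g -> (exists u, g u <> 0) ->
    exists p u, sm_part p u /\ g u <> 0.
  move=> gl [u]; have [v0 [v1 [h0 h1 ->]]] := graded_sum (sm_graded U) u.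
  rewrite (linD _ _ gl); have [->|/eqP nz] := eqVneq (g v0) 0.
    by rewrite add0r => nz; exists true, v1.
  by move=> _; exists false, v0.
have [p [f [hf [v nv]]]] := regular_hom U_fin U_simple.1.
have [q [u1 [hu1 nf]]] := split_hom _ f (hh_linear hf) (ex_intro _ v nv).
pose y : A := f u1; have hy : sa_part (q (+) p) y by apply: (hh_part hf).
have hfG := (regular_homog_emb p f).1 hf.
pose fG : G := homog_elt hfG.
have [p0 [u0 [hu0 n0]]] : exists p0 (u0 : U), sm_part p0 u0 /\ sm_act (reversal y) u0 <> 0.
  apply: (split_hom _ (fun u : U => sm_act (reversal y) u) (sm_actr (reversal y))).
  apply: boolp.contrapT => h; apply: nf.
  rewrite -/y -[y]reversalK (@cliff_faithful C n two U (reversal y)).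
  - exact: lin0 (@reversal_linear C n two).
  - by exists m.
  - by move=> u; apply: boolp.contrapT => hu; apply: h; exists u.
have hth := eval_map_hom hu1 hu0.
have nth : exists g, eval_map q p0 u1 u0 g <> 0.
  exists fG => /eqP; rewrite /eval_map -[hom_fun _ _]/y.
  rewrite (parity_twist_homog _ (reversal_part hy)).
  rewrite (linZ _ _ (sm_actl _)) scaler_eq0 (negPf (introN eqP n0)) orbF.
  rewrite mulf_eq0 (negPf two) /=; case: (_ (+) _); rewrite ?oner_eq0 //.
  by rewrite mulf_eq0 signr_eq0 oppr_eq0 orbF -sqrf_eq0 sqr_i oppr_eq0 oner_eq0.
have sth := schur_surj two (basic_spin_simple U_simple) hth nth.
have [k [b [bl [b' bK b'K]]]] := U_fin.
have thl := hh_linear hth.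
have b'l : linear b' by move=> a x z; apply: (can_inj bK); rewrite bl !b'K.
exists (q (+) p0), (eval_map q p0 u1 u0); split=> //.
(* The coordinates of the functional scalar_part o g on U. *)
pose J (g : G) : 'rV[C]_k := \row_j scalar_part (hom_fun g (b' (delta_mx 0 j)) : A).
have Jl : linear J.
  move=> a g h; apply/rowP=> j; rewrite !mxE.
  rewrite [hom_fun _ _]/(a *: hom_fun g _ + hom_fun h _).
  exact: (@scalar_part_linear C n two).
have hl (g : G) : linear (hom_fun g).
  have [g0 [g1 [h0 h1 eg]]] := hom_spaceP g.
  move=> a x z; rewrite !eg (hh_linear h0) (hh_linear h1) scalerDr.
  by rewrite addrACA.
have Ji : injective J.
  move=> g h /eqP; rewrite -subr_eq0 -scaleN1r addrC -Jl => /eqP e.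
  apply/eqP; rewrite -subr_eq0 -scaleN1r addrC; apply/eqP/scalar_part_separates_homs => u.
  move: (_ *: h + g) e => g' {g h} e.
  rewrite -(bK u) [b u]row_sum_delta.
  have tl : linear (fun v : 'rV_k => scalar_part (hom_fun g' (b' v) : A) : C^o).
    by move=> a x z; rewrite b'l hl (@scalar_part_linear C n two).
  rewrite (big_morph (fun v : 'rV_k => scalar_part (hom_fun g' (b' v) : A))
    (fun x y => linD x y tl) (lin0 tl)).
  apply: big1 => j _; rewrite (linZ _ _ tl).
  by have /rowP /(_ j) := e; rewrite !mxE => ->; rewrite scaler0.
have ti : injective (b \o eval_map q p0 u1 u0).
  apply: (surj_inj_of_embedding _ Jl _ Ji).
    by move=> a x z; rewrite /= thl bl.
  by move=> r; have [g hg] := sth (b' r); exists g; rewrite /= -hg b'K.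
have ti' : injective (eval_map q p0 u1 u0).
  by move=> g h e; apply: ti; rewrite /= e.
have /boolp.choice [inv hinv] := sth.
by exists inv => [g|u]; [apply: ti' |]; rewrite -hinv.
Qed.

End FunctorG.
End Spin.

Theorem theorem3p5 (R : realType) (W : weyl_group R) (U : smodule (clV W))
  (U_fin : fin_dim U) (U_simple : simple_module U) :
  (simple_module (basic_spin U) /\
   (~~ odd (rank W) -> typeM (basic_spin U)) /\
   (odd (rank W) -> typeQ (basic_spin U))) /\
  siso (functorG U (clV_module W)) (basic_spin U) /\
  (simple_module (clV_module W) /\ typeM (clV_module W)).
Proof.
split; last by split; [exact: functorG_iso
  | split; [exact: clV_module_simple | exact: clV_module_typeM]].
split; first exact: basic_spin_simple.
by split; [exact: basic_spin_typeM | exact: basic_spin_typeQ].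
Qed.
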